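(* Let $a<b$ be real and $\mathbf n,\mathbf m,\mathbf k\in\mathbb N^2$. Let $G:\mathbf L^{\mathbf n}_{e,[a,b]}\to\mathbf L^{\mathbf m}_{e,[a,b]}$ be a causal bounded linear operator, and suppose there exist PI operators $\mathcal T,\mathcal A:\mathbf Z^{\mathbf k}\to\mathbf Z^{\mathbf k}$, $\mathcal B:\mathbf Z^{\mathbf n}\to\mathbf Z^{\mathbf k}$, $\mathcal C:\mathbf Z^{\mathbf k}\to\mathbf Z^{\mathbf m}$, $\mathcal D:\mathbf Z^{\mathbf n}\to\mathbf Z^{\mathbf m}$ such that for every $\mathbf u\in\mathbf L^{\mathbf n}_{e,[a,b]}$, $\mathbf y=G\mathbf u$ implies that there is $\mathbf x\in\mathbf L^{\mathbf k}_{e,[a,b]}$ with zero initial condition such that $$\mathcal T\dot{\mathbf x}(t)=\mathcal A\mathbf x(t)+\mathcal B\mathbf u(t),\qquad \mathbf y(t)=\mathcal C\mathbf x(t)+\mathcal D\mathbf u(t).$$ Let $\mathcal K$ be a PI operator on $\mathbf Z^{\mathbf m}$, and suppose there exist $\varepsilon>0$ and a PI operator $\mathcal P$ on $\mathbf Z^{\mathbf k}$ such that $\mathcal P\ge0$ and $$\begin{bmatrix}\mathcal T^*\mathcal P\mathcal A+\mathcal A^*\mathcal P\mathcal T&\mathcal T^*\mathcal P\mathcal B\\ \mathcal B^*\mathcal P\mathcal T&\varepsilon I\end{bmatrix}+\begin{bmatrix}\mathcal C^*\\ \mathcal D^*\end{bmatrix}\mathcal K\begin{bmatrix}\mathcal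 C&\mathcal D\end{bmatrix}\le0 .$$ Then for every $\mathbf u\in\mathbf L^{\mathbf n}_{e,[a,b]}$ and every $T>0$, $$\left\langle P_TG\mathbf u,\,P_TM_{\mathcal K}G\mathbf u\right\rangle_{\mathbf L}\le-\varepsilon\,\|P_T\mathbf u\|_{\mathbf L}^2 .$$
   Context: Signal spaces. For $\mathbf n=(n_1,n_2)\in\mathbb N^2$, $\mathbf Z^{\mathbf n}:=\mathbb R^{n_1}\times L_2^{n_2}[a,b]$ is the real Hilbert space with inner product $\langle(u,U),(v,V)\rangle_{\mathbf Z}=u^Tv+\int_a^bU(s)^TV(s)\,ds$. $\mathbf L^{\mathbf n}_{e,[a,b]}$ is the space of (strongly measurable) functions $\mathbf u:[0,\infty)\to\mathbf Z^{\mathbf n}$ with $\int_0^T\|\mathbf u(t)\|_{\mathbf Z}^2dt<\infty$ for all $T\ge0$; $\langle\mathbf u,\mathbf v\rangle_{\mathbf L}=\int_0^\infty\langle\mathbf u(t),\mathbf v(t)\rangle_{\mathbf Z}dt$ for square-integrable $\mathbf u,\mathbf v:[0,\infty)\to\mathbf Z^{\mathbf n}$, with norm $\|\cdot\|_{\mathbf L}$. $(P_\tau\mathbf y)(t)=\mathbf y(t)$ for $0\le t\le\tau$ and $0$ otherwise. For a bounded linear $\mathcal K$, $(M_{\mathcal K}\mathbf w)(t):=\mathcal K\mathbf w(t)$. An operator $F$ between such extended spaces is causal if $P_\tau F=P_\tau FP_\tau$ for all $\tau\ge0$, and bounded if there is $C\ge0$ with $\|P_\tau F\mathbf v\|_{\mathbf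 L}\le C\|P_\tau\mathbf v\|_{\mathbf L}$ for all $\mathbf v$ and $\tau\ge0$. PI operators. A Partial Integral (PI) operator $\mathbf Z^{\mathbf p}\to\mathbf Z^{\mathbf q}$ is a map of the form $$\begin{bmatrix}x\\ \mathbf x\end{bmatrix}\mapsto\begin{bmatrix}Px+\int_a^bQ_1(s)\mathbf x(s)\,ds\\ Q_2(s)x+R_0(s)\mathbf x(s)+\int_a^sR_1(s,\theta)\mathbf x(\theta)\,d\theta+\int_s^bR_2(s,\theta)\mathbf x(\theta)\,d\theta\end{bmatrix}$$ with $P$ a matrix, $Q_1,Q_2,R_0$ bounded (measurable) matrix-valued functions and $R_1,R_2$ separable (finite sums of products of a bounded function of $s$ and a bounded function of $\theta$), of appropriate dimensions. PI operators are bounded linear operators; the class is closed under sums, compositions and adjoints; $^*$ is the Hilbert space adjoint. Conventions. $\mathcal P\ge0$ means $\mathcal P=\mathcal P^*$ and $\langle z,\mathcal Pz\rangle\ge0$ for all $z$; an operator $\mathcal M$ (here on $\mathbf Z^{\mathbf k}\times\mathbf Z^{\mathbf n}$) satisfies $\mathcal M\le0$ if $\langle z,\mathcal Mz\rangle\le0$ for all $z$. The equation $\mathcal T\dot{\mathbf x}=\mathcal A\mathbf x+\mathcal B\mathbf u$ with zero initial condition means that $t\mapsto\mathcal T\mathbf x(t)$ is (has a representative that is) locally absolutely continuous on $[0,\infty)$, vanishes at $t=0$, and its derivative, written $\mathcal T\dot{\mathbf x}(t)$, equals $\mathcal A\mathbf x(t)+\mathcal B\mathbf u(t)$ for almost every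 $t$; the output equation holds for almost every $t$. *)

(* Defs.v *)
From HB Require Import structures.
From mathcomp Require Import all_boot all_order all_algebra.
From mathcomp Require Import all_classical all_reals all_analysis.

Set Implicit Arguments.
Unset Strict Implicit.
Unset Printing Implicit Defensive.

Import Order.TTheory GRing.Theory Num.Theory.
Import numFieldNormedType.Exports.

Local Open Scope classical_set_scope.
Local Open Scope ring_scope.

(* Elements of Z^n = R^n1 x L_2^n2[a,b] are handled through representatives:
   a point of [Zrep R n] denotes an element of Z^n when it satisfies [inZ], and
   two representatives denote the same element when they are related by [eqZ].
   Only the values of the second component on [a,b] matter. *)
Definition Zrep (R : realType) (n : nat * nat) : lmodType R :=
  ('cV[R]_n.1 * (R -> 'cV[R]_n.2))%type.

Definition dot (R : realType) (p : nat) (u v : 'cV[R]_p) : R :=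
  (u^T *m v) 0 0.

Definition vint (R : realType) (p : nat) (D : set R) (f : R -> 'cV[R]_p) :
    'cV[R]_p :=
  \col_i \int[lebesgue_measure]_(s in D) f s i 0.

Definition inZ (R : realType) (a b : R) (n : nat * nat) (z : Zrep R n) : Prop :=
  (forall i, measurable_fun `[a, b] (fun s => z.2 s i 0)) /\
  (\int[lebesgue_measure]_(s in `[a, b]) (dot (z.2 s) (z.2 s))%:E < +oo)%E.

Definition eqZ (R : realType) (a b : R) (n : nat * nat) (z w : Zrep R n) :
    Prop :=
  z.1 = w.1 /\
  {ae lebesgue_measure, forall s : R, s \in `[a, b] -> z.2 s = w.2 s}.

Definition innerZ (R : realType) (a b : R) (n : nat * nat) (z w : Zrep R n) :
    R :=
  dot z.1 w.1 + \int[lebesgue_measure]_(s in `[a, b]) dot (z.2 s) (w.2 s).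

Definition normZ (R : realType) (a b : R) (n : nat * nat) (z : Zrep R n) : R :=
  Num.sqrt (innerZ a b z z).

(* Signals are functions of time R -> Zrep R n of which only the values at
   times t >= 0 matter. *)

Definition simpleZ (R : realType) (a b : R) (n : nat * nat)
    (f : R -> Zrep R n) : Prop :=
  exists (r : nat) (E : 'I_r -> set R) (c : 'I_r -> Zrep R n),
    [/\ forall i, measurable (E i),
        forall i, inZ a b (c i) &
        forall t, f t = \sum_(i < r) (\1_(E i) t : R) *: c i].

Definition strongly_measurableZ (R : realType) (a b : R) (n : nat * nat)
    (u : R -> Zrep R n) : Prop :=
  exists f : nat -> R -> Zrep R n,
    (forall j, simpleZ a b (f j)) /\
    (forall t : R, 0 <= t -> normZ a b (f j t - u t) @[j --> \oo] --> (0 : R)).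

Definition inLe (R : realType) (a b : R) (n : nat * nat) (u : R -> Zrep R n) :
    Prop :=
  [/\ forall t : R, 0 <= t -> inZ a b (u t),
      strongly_measurableZ a b u &
      forall tau : R, 0 <= tau ->
        (\int[lebesgue_measure]_(t in `[0%R, tau])
           (normZ a b (u t) ^+ 2)%:E < +oo)%E].

Definition eqLe (R : realType) (a b : R) (n : nat * nat)
    (u v : R -> Zrep R n) : Prop :=
  {ae lebesgue_measure, forall t : R, 0 <= t -> eqZ a b (u t) (v t)}.

Definition innerL (R : realType) (a b : R) (n : nat * nat)
    (u v : R -> Zrep R n) : R :=
  \int[lebesgue_measure]_(t in `[0%R, +oo[) innerZ a b (u t) (v t).

Definition normL (R : realType) (a b : R) (n : nat * nat)
    (u : R -> Zrep R n) : R :=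
  Num.sqrt (innerL a b u u).

Definition trunc (R : realType) (n : nat * nat) (tau : R) (y : R -> Zrep R n) :
    R -> Zrep R n :=
  fun t => if 0 <= t <= tau then y t else 0.

Definition mulop (R : realType) (n m : nat * nat) (K : Zrep R n -> Zrep R m)
    (w : R -> Zrep R n) : R -> Zrep R m :=
  fun t => K (w t).

(* A map between extended spaces, given on representatives: it preserves
   membership and descends to a.e. classes. *)
Definition Le_operator (R : realType) (a b : R) (n m : nat * nat)
    (F : (R -> Zrep R n) -> (R -> Zrep R m)) : Prop :=
  (forall u, inLe a b u -> inLe a b (F u)) /\
  (forall u v, inLe a b u -> inLe a b v -> eqLe a b u v ->
     eqLe a b (F u) (F v)).

Definition Le_linear (R : realType) (a b : R) (n m : nat * nat)
    (F : (R -> Zrep R n) -> (R -> Zrep R m)) : Prop :=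
  forall (c : R) u v, inLe a b u -> inLe a b v ->
    eqLe a b (F (c *: u + v)) (c *: F u + F v).

Definition causal (R : realType) (a b : R) (n m : nat * nat)
    (F : (R -> Zrep R n) -> (R -> Zrep R m)) : Prop :=
  forall tau : R, 0 <= tau -> forall u, inLe a b u ->
    eqLe a b (trunc tau (F u)) (trunc tau (F (trunc tau u))).

Definition Le_bounded (R : realType) (a b : R) (n m : nat * nat)
    (F : (R -> Zrep R n) -> (R -> Zrep R m)) : Prop :=
  exists2 C : R, 0 <= C & forall u, inLe a b u -> forall tau : R, 0 <= tau ->
    normL a b (trunc tau (F u)) <= C * normL a b (trunc tau u).

Definition bounded_meas (R : realType) (a b : R) (p q : nat)
    (F : R -> 'M[R]_(p, q)) : Prop :=
  (forall i j, measurable_fun `[a, b] (fun s => F s i j)) /\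
  (exists M : R, forall s, s \in `[a, b] -> forall i j, `|F s i j| <= M).

(* A common inner dimension [d] is no restriction, by padding with zeros. *)
Definition separable (R : realType) (a b : R) (p q : nat)
    (N : R -> R -> 'M[R]_(p, q)) : Prop :=
  exists (r d : nat) (F : 'I_r -> R -> 'M[R]_(p, d))
         (H : 'I_r -> R -> 'M[R]_(d, q)),
    [/\ forall i, bounded_meas a b (F i),
        forall i, bounded_meas a b (H i) &
        forall s theta, s \in `[a, b] -> theta \in `[a, b] ->
          N s theta = \sum_(i < r) F i s *m H i theta].

Record PIop (R : realType) (a b : R) (p q : nat * nat) := MkPIop {
  PI_P : 'M[R]_(q.1, p.1);
  PI_Q1 : R -> 'M[R]_(q.1, p.2);
  PI_Q2 : R -> 'M[R]_(q.2, p.1);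
  PI_R0 : R -> 'M[R]_(q.2, p.2);
  PI_R1 : R -> R -> 'M[R]_(q.2, p.2);
  PI_R2 : R -> R -> 'M[R]_(q.2, p.2);
  _ : bounded_meas a b PI_Q1;
  _ : bounded_meas a b PI_Q2;
  _ : bounded_meas a b PI_R0;
  _ : separable a b PI_R1;
  _ : separable a b PI_R2 }.

Definition PI_apply (R : realType) (a b : R) (p q : nat * nat)
    (K : PIop a b p q) (z : Zrep R p) : Zrep R q :=
  (PI_P K *m z.1 + vint `[a, b] (fun s => PI_Q1 K s *m z.2 s),
   fun s => PI_Q2 K s *m z.1 + PI_R0 K s *m z.2 s
            + vint `[a, s] (fun theta => PI_R1 K s theta *m z.2 theta)
            + vint `[s, b] (fun theta => PI_R2 K s theta *m z.2 theta)).

Coercion PI_apply : PIop >-> Funclass.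

(* Hilbert space adjoint: [adjoint K w] is a representative of the element v
   of Z^p (unique up to [eqZ]) such that <K z, w> = <z, v> for all z; for a
   bounded linear K it exists, so that the default value 0 is not used. *)
Definition adjoint (R : realType) (a b : R) (p q : nat * nat)
    (K : Zrep R p -> Zrep R q) (w : Zrep R q) : Zrep R p :=
  xget 0 [set v | inZ a b v /\
                  forall z, inZ a b z -> innerZ a b (K z) w = innerZ a b z v].

Definition psd (R : realType) (a b : R) (p : nat * nat)
    (P : Zrep R p -> Zrep R p) : Prop :=
  (forall z, inZ a b z -> eqZ a b (P z) (adjoint a b P z)) /\
  (forall z, inZ a b z -> 0 <= innerZ a b z (P z)).

Definition block_op (V1 V2 W1 W2 : nmodType) (A : V1 -> W1) (B : V2 -> W1)
    (C : V1 -> W2) (D : V2 -> W2) (z : V1 * V2) : W1 * W2 :=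
  (A z.1 + B z.2, C z.1 + D z.2).

Definition col_op (V W1 W2 : nmodType) (A : V -> W1) (B : V -> W2) (z : V) :
    (W1 * W2)%type :=
  (A z, B z).

Definition row_op (V1 V2 W : nmodType) (A : V1 -> W) (B : V2 -> W)
    (z : V1 * V2) : W :=
  A z.1 + B z.2.

Definition nsd_block (R : realType) (a b : R) (k n : nat * nat)
    (M : Zrep R k * Zrep R n -> Zrep R k * Zrep R n) : Prop :=
  forall z, inZ a b z.1 -> inZ a b z.2 ->
    innerZ a b z.1 (M z).1 + innerZ a b z.2 (M z).2 <= 0.

Definition loc_abs_cont (R : realType) (a b : R) (n : nat * nat)
    (v : R -> Zrep R n) : Prop :=
  forall tau : R, 0 < tau -> forall e : R, 0 < e -> exists2 d : R, 0 < d &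
    forall (r : nat) (l h : 'I_r -> R),
      (forall i, [/\ 0 <= l i, l i <= h i & h i <= tau]) ->
      (forall i j, i != j -> h i <= l j \/ h j <= l i) ->
      \sum_(i < r) (h i - l i) < d ->
      \sum_(i < r) normZ a b (v (h i) - v (l i)) < e.

Definition has_derivZ (R : realType) (a b : R) (n : nat * nat)
    (v : R -> Zrep R n) (t : R) (w : Zrep R n) : Prop :=
  normZ a b (h^-1 *: (v (t + h) - v t) - w) @[h --> (0 : R)^'] --> (0 : R).

(* d/dt (T x) = A x + B u with zero initial condition; [v] is the locally
   absolutely continuous representative of t |-> T (x t). *)
Definition state_eq (R : realType) (a b : R) (k n : nat * nat)
    (T A : Zrep R k -> Zrep R k) (B : Zrep R n -> Zrep R k)
    (u : R -> Zrep R n) (x : R -> Zrep R k) : Prop :=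
  exists v : R -> Zrep R k,
    [/\ forall t : R, 0 <= t -> inZ a b (v t),
        eqLe a b v (mulop T x),
        loc_abs_cont a b v,
        eqZ a b (v 0) 0 &
        {ae lebesgue_measure, forall t : R, 0 < t ->
           has_derivZ a b v t (A (x t) + B (u t))}].

(* Main.v *)
Require Import Defs.
From HB Require Import structures.
From mathcomp Require Import all_boot all_order all_algebra.
From mathcomp Require Import all_classical all_reals all_analysis.
From mathcomp Require Import measurable_realfun ring lra.

Set Implicit Arguments.
Unset Strict Implicit.
Unset Printing Implicit Defensive.

Import Order.TTheory GRing.Theory Num.Theory.
Import numFieldNormedType.Exports.

Local Open Scope classical_set_scope.
Local Open Scope ring_scope.

(* Along a solution, let v be the absolutely continuous representative of T x
   and phi t := <v t, P (v t)>.  For almost every t the derivative of phi is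
   2 <T x, P (A x + B u)>, which the operator inequality bounds by
   - eps |u|^2 - <y, K y>.  As phi 0 = 0 and 0 <= phi tau, integrating over
   [0, tau] gives the claim.  The inequality is stated with Hilbert adjoints, so
   one needs that they exist: a PI operator is a sum of composites of
   multiplications, integration over [a, b], constants and the two Volterra
   operators, the adjoints of the last ones being exchanged by Fubini. *)

(** * Absolutely continuous real functions *)

(** The sum of [phi] and the primitive of [eps * |u|^2 + <y, K y>] has a nonpositive derivative at
    almost every time. For a function of Cantor type this would not prevent growth, so absolute
    continuity has to be carried along: from v to [phi] by means of the bound on P, and to the
    primitive because its integrand is integrable. The derivative is taken along v and not along T
    x, since the two agree only at almost every time; this is enough for the pointwise inequality.
    The other obstacle is that elements of Z are representatives. An operator is therefore always
    observed through inner products: [adjointable] combines an explicit adjoint with a norm bound,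
    is stable under sums and composites, and yields linearity and independence of the representative
    once the result is paired with a vector. *)

(* The supremum argument behind Cousin's lemma. *)
Lemma interval_induction (R : realType) (tau : R) (P : R -> R -> Prop) :
  0 <= tau ->
  (forall l m h, P l m -> P m h -> P l h) ->
  (forall t, 0 <= t <= tau -> exists2 d, 0 < d &
     forall l h, 0 <= l -> h <= tau -> t - d < l -> l <= t -> t <= h ->
       h < t + d -> P l h) ->
  P 0 tau.
Proof.
move=> tau0 Ptrans Ploc.
pose S := [set t | 0 <= t <= tau /\ P 0 t].
have S0 : S 0.
  split; first by rewrite lexx.
  have [|d d0 H] := Ploc 0; first by rewrite lexx.
  by apply: H => //; lra.
have ubS : ubound S tau by move=> t [/andP[]].
have supS : has_sup S by split; [exists 0|exists tau].
set s := sup S.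
have s0 : 0 <= s by apply: ub_le_sup => //; exists tau.
have stau : s <= tau by apply: ge_sup => //; exists 0.
have [|d d0 H] := Ploc s; first by rewrite s0.
have [t [/andP[t0 ttau] Pt] sdt] := sup_adherent d0 supS.
have ts : t <= s by apply: ub_le_sup; [exists tau|split=> //; apply/andP].
have [stau'|] := ltP s tau; last first.
  move=> taus; have -> : tau = s by apply/eqP; rewrite eq_le taus stau.
  by apply: (Ptrans _ t) => //; apply: H => //; lra.
(* The local hypothesis at [s] reaches beyond [s], against the choice of [s] as a supremum; the
   minimum keeps the new point below [tau]. *)
pose h := Num.min (s + d / 2) tau.
have sh : s < h by rewrite lt_min stau' andbT; lra.
have Sh : S h.
  split; first by rewrite ge_min lexx orbT andbT; lra.
  apply: (Ptrans _ t) => //; apply: H => //; first by rewrite ge_min lexx orbT.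
  - exact: ltW.
  - by rewrite gt_min; apply/orP; left; lra.
have : h <= s by apply: ub_le_sup => //; exists tau.
by rewrite leNgt sh.
Qed.

Definition abs_cont_on (R : realType) (tau : R) (f : R -> R) : Prop :=
  forall e : R, 0 < e -> exists2 d : R, 0 < d &
    forall (r : nat) (l h : 'I_r -> R),
      (forall i, [/\ 0 <= l i, l i <= h i & h i <= tau]) ->
      (forall i j, i != j -> h i <= l j \/ h j <= l i) ->
      \sum_(i < r) (h i - l i) < d ->
      \sum_(i < r) `|f (h i) - f (l i)| < e.

(** Gluing two families of intervals is concatenation when they are ordered lists; comparing two
    indices then tells which of the two intervals lies on the left. *)
Lemma abs_cont_on_seq (R : realType) (tau : R) (f : R -> R) (e d : R) :
  (forall (r : nat) (l h : 'I_r -> R),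
      (forall i, [/\ 0 <= l i, l i <= h i & h i <= tau]) ->
      (forall i j, i != j -> h i <= l j \/ h j <= l i) ->
      \sum_(i < r) (h i - l i) < d ->
      \sum_(i < r) `|f (h i) - f (l i)| < e) ->
  forall s : seq (R * R),
    all (fun p => [&& 0 <= p.1, p.1 <= p.2 & p.2 <= tau]) s ->
    pairwise (fun p q => p.2 <= q.1) s ->
    \sum_(p <- s) (p.2 - p.1) < d -> \sum_(p <- s) `|f p.2 - f p.1| < e.
Proof.
move=> H s sall spw.
rewrite !(big_nth (0, 0)) !big_mkord; apply: H.
  by move=> i; have /(all_nthP (0, 0))/(_ i (ltn_ord i))/and3P[] := sall.
move=> i j; rewrite neq_ltn => /orP[] ij; [left|right].
  by have /(pairwiseP (0, 0)) := spw; apply=> //; apply: ltn_ord.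
by have /(pairwiseP (0, 0)) := spw; apply=> //; apply: ltn_ord.
Qed.

(** Outer regularity, applied to a measurable null set that contains the exceptional points. *)
Lemma ae_open_cover (R : realType) (P : R -> Prop) (d : R) : 0 < d ->
  {ae (@lebesgue_measure R), forall t, P t} ->
  exists U : set R, [/\ open U, (@lebesgue_measure R U < d%:E)%E &
    forall t, ~ P t -> U t].
Proof.
move=> d0 [N [mN N0 PN]].
have [|U [oU NU UN]] := lebesgue_regularity_outer mN _ d0; first by rewrite [X in (X < _)%E]N0 ltry.
exists U; split => //; last by move=> t Pt; apply/NU/PN.
have mU : measurable U by exact: open_measurable.
apply: le_lt_trans UN.
rewrite (measureDI (@lebesgue_measure R) mU mN) -[leRHS]adde0 leeD2l// -N0.
by apply: le_measure; rewrite ?inE//; exact: measurableI.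
Qed.

(** Fix a small slope [e]. Around a time with nonpositive derivative [f] grows at most at slope [e];
    the remaining times lie in an open set so small that absolute continuity limits the growth over
    it to [e]. [interval_induction] assembles these local estimates. *)
Lemma abs_cont_on_le (R : realType) (tau : R) (f : R -> R) : 0 < tau ->
  abs_cont_on tau f ->
  {ae (@lebesgue_measure R), forall t, 0 < t < tau -> exists2 D : R, D <= 0 &
     h^-1 * (f (t + h) - f t) @[h --> (0 : R)^'] --> D} ->
  f tau <= f 0.
Proof.
move=> tau0 acf aef.
apply/ler_addgt0Pr => e e0.
suff H : forall e, 0 < e -> f tau - f 0 <= e * tau + e.
  have /H : 0 < e / (tau + 1) by apply: divr_gt0 => //; lra.
  have -> : e / (tau + 1) * tau + e / (tau + 1) = e by field; lra.
  lra.
move=> {e0}e e0.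
have [d d0 /abs_cont_on_seq fd] := acf e e0.
pose good t := (0 < t < tau) /\ exists2 D : R, D <= 0 &
     h^-1 * (f (t + h) - f t) @[h --> (0 : R)^'] --> D.
have aegood : {ae (@lebesgue_measure R), forall t, good t \/ ~ (0 <= t <= tau)}.
  (* Nothing is assumed at 0 and [tau], which join the exceptional null set. *)
  have ne0 t : {ae (@lebesgue_measure R), forall x, x != t}.
    exists [set t]; split => //; first by rewrite lebesgue_measure_set1.
    by move=> x /= /negP; rewrite negbK => /eqP.
  move: aef (ne0 0) (ne0 tau).
  apply: filterS3; first exact: (ae_filter_ringOfSetsType (@lebesgue_measure R)).
  move=> t H t0 tt.
  have [/andP[tge tle]|] := boolP (0 <= t <= tau); last by right; apply/negP.
  have tin : 0 < t < tau by rewrite !lt_neqAle tge tle eq_sym t0 tt.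
  by left; split => //; exact: H.
have [U [oU Ud UN]] := ae_open_cover d0 aegood.
have mU : measurable U by exact: open_measurable.
(* s collects the intervals met inside the open set U covering the exceptional
   times; its total length is kept below the measure of U, so that absolute
   continuity makes the last sum smaller than e. *)
pose P l h := l <= h /\ exists s : seq (R * R),
  [/\ all (fun p => [&& l <= p.1, p.1 <= p.2 & p.2 <= h]) s,
      pairwise (fun p q => p.2 <= q.1) s,
      ((\sum_(p <- s) (p.2 - p.1))%:E <=
         @lebesgue_measure R (U `&` `]l, h]))%E &
      f h - f l <= e * (h - l) + \sum_(p <- s) `|f p.2 - f p.1|].
have : P 0 tau.
  apply: interval_induction; first exact: ltW.
    move=> l m h [lm [s [sall spw sU sf]]] [mh [s' [sall' spw' sU' sf']]].
    split; first exact: le_trans mh.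
    exists (s ++ s'); split.
    - rewrite all_cat; apply/andP; split.
        apply: sub_all sall => p /and3P[-> -> /= /le_trans]; exact.
      by apply: sub_all sall' => p /and3P[p1 -> ->]; rewrite !andbT (le_trans lm).
    - rewrite pairwise_cat spw spw' !andbT; apply/allrelP => p q ps qs.
      have /allP/(_ _ ps)/and3P[_ _ pm] := sall.
      have /allP/(_ _ qs)/and3P[mq _ _] := sall'.
      exact: le_trans mq.
    - rewrite big_cat /= EFinD.
      (* Half-open intervals make the two traces on [U] disjoint, so their measures add up. *)
      have -> : U `&` `]l, h] = (U `&` `]l, m]) `|` (U `&` `]m, h]).
        by rewrite -setIUr -itv_bndbnd_setU// bnd_simp.
      rewrite measureU//; [|exact: measurableI|exact: measurableI|].
        exact: leeD.
      rewrite -subset0 => x [[_ xlm] [_ xmh]]; move: xlm xmh.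
      by rewrite /= !in_itv/= => /andP[_ xm] /andP[/lt_le_trans/(_ xm)]; rewrite ltxx.
    - rewrite big_cat /=; lra.
  move=> t tin.
  (* At a good time the difference quotients are eventually below [e], and the empty list suffices.
     The quotients are based at [t], hence the separate estimates on its two sides. *)
  have [[/andP[t0 tt] [D D0 /cvgrPdist_lt /(_ e e0)]]|ngood] := pselect (good t).
    case=> r /= r0 rP.
    have rP' k : k != 0 -> `|k| < r -> k^-1 * (f (t + k) - f t) < e.
      move=> k0 kr; have := rP k; rewrite /= sub0r normrN => /(_ kr k0).
      rewrite ltr_norml => /andP[]; lra.
    exists r => // l h l0 ht tl lt th hr; split; first exact: le_trans th.
    exists [::]; split => //; first by rewrite big_nil.
    rewrite big_nil addr0.
    have H1 : f h - f t <= e * (h - t).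
      have [->|nht] := eqVneq h t; first by rewrite !subrr mulr0.
      have ht0 : 0 < h - t by rewrite subr_gt0 lt_neqAle eq_sym nht.
      have := rP' (h - t); rewrite gt_eqF// gtr0_norm// subrKC => /(_ isT).
      by rewrite ltr_pdivrMl// mulrC => H; apply/ltW/H; lra.
    have H2 : f t - f l <= e * (t - l).
      have [->|nlt] := eqVneq l t; first by rewrite !subrr mulr0.
      have lt0 : l - t < 0 by rewrite subr_lt0 lt_neqAle nlt.
      have := rP' (l - t); rewrite lt_eqF// ltr0_norm// subrKC => /(_ isT).
      by rewrite ltr_ndivrMl// => H; have := H _; lra.
    lra.
  (* An exceptional time has a neighbourhood inside [U]; the single interval from [l] to [h] is
     listed, and its own increment accounts for the growth. *)
  have Ut : U t by apply: UN => -[//|]; apply.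
  have /nbhs_ballP[r /= r0 rU] : nbhs t U by apply: open_nbhs_nbhs; split.
  exists r => // l h l0 ht tl lt th hr.
  have lh : l <= h by exact: le_trans th.
  split => //; exists [:: (l, h)]; split => //=.
  - by rewrite !lexx lh.
  - rewrite big_seq1 /= setIidr.
      rewrite lebesgue_measure_itv/= lte_fin; case: ltP => //= hl.
      by rewrite lee_fin; lra.
    move=> x /=; rewrite in_itv/= => /andP[lx xh]; apply: rU.
    by rewrite /ball/= ltr_norml; apply/andP; split; lra.
  - rewrite big_seq1 /=.
    have := ler_norm (f h - f l).
    by have : 0 <= e * (h - l); [apply: mulr_ge0; lra|lra].
case=> _ [s [sall spw sU sf]].
have sd : \sum_(p <- s) (p.2 - p.1) < d.
  rewrite -lte_fin; apply: le_lt_trans sU _; apply: le_lt_trans Ud.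
  by apply: le_measure; rewrite ?inE//; exact: measurableI.
by have := fd s sall spw sd; rewrite subr0 in sf; lra.
Qed.

(** * The space Z *)

Lemma measurable_itvR (R : realType) (a b : R) :
  measurable (`[a, b]%classic : set (measurableTypeR R)).
Proof. exact: measurable_itv. Qed.

Definition sqint (R : realType) (a b : R) (f : R -> R) : Prop :=
  measurable_fun `[a, b] f /\
  (@lebesgue_measure R).-integrable `[a, b] (EFin \o (fun s => f s ^+ 2)).

Lemma sqint_mul_integrable (R : realType) (a b : R) (f g : R -> R) :
  sqint a b f -> sqint a b g ->
  (@lebesgue_measure R).-integrable `[a, b] (EFin \o (fun s => f s * g s)).
Proof.
move=> [mf f2] [mg g2].
have fg2 := integrableD (measurable_itvR a b) f2 g2.
apply: le_integrable fg2 => //.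
  by apply/measurable_EFinP; exact: measurable_funM.
move=> s _; rewrite /= lee_fin normrM.
rewrite [leRHS]ger0_norm ?addr_ge0 ?sqr_ge0//.
rewrite -(real_normK (num_real (f s))) -(real_normK (num_real (g s))).
have := sqr_ge0 (`|f s| - `|g s|); have := sqr_ge0 (`|f s|); have := sqr_ge0 (`|g s|).
rewrite !expr2; lra.
Qed.

Lemma sqint_dominated (R : realType) (a b M : R) (f g : R -> R) :
  measurable_fun `[a, b] g -> sqint a b f ->
  (forall s, s \in `[a, b] -> `|g s| <= M * `|f s|) -> sqint a b g.
Proof.
move=> mg [mf f2] gf; split => //.
have M2f2 := integrableZl (measurable_itvR a b) (M ^+ 2) f2.
apply: le_integrable M2f2 => //.
  by apply/measurable_EFinP; exact: measurable_funX.
move=> s abs; rewrite /= lee_fin.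
rewrite normrX [leRHS]normrM !normrX -exprMn.
rewrite ler_sqr ?nnegrE ?mulr_ge0//.
by apply: le_trans (gf s abs) _; rewrite ler_wpM2r// ler_norm.
Qed.

Lemma sqint_cst (R : realType) (a b c : R) : sqint a b (cst c).
Proof.
split; first exact: measurable_cst.
apply: (measurable_bounded_integrable (measurable_itvR a b)).
- by rewrite /= lebesgue_measure_itv/=; case: ifP => _; rewrite ?ltry// -EFinB ltry.
- by apply: measurable_funX; exact: measurable_cst.
- by exists (c ^+ 2); split; [exact: num_real|move=> x cx s _ /=; rewrite ger0_norm ?sqr_ge0//; exact: ltW].
Qed.

Lemma sqint_integrable (R : realType) (a b : R) (f : R -> R) : sqint a b f ->
  (@lebesgue_measure R).-integrable `[a, b] (EFin \o f).
Proof.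
move=> /(sqint_mul_integrable (sqint_cst a b 1)).
by apply: eq_integrable => // s _ /=; rewrite mul1r.
Qed.

Lemma sqintZD (R : realType) (a b c : R) (f g : R -> R) :
  sqint a b f -> sqint a b g -> sqint a b (fun s => c * f s + g s).
Proof.
move=> sf sg; have fg := sqint_mul_integrable sf sg.
case: sf sg => [mf f2] [mg g2]; split.
  by apply: measurable_funD => //; apply: measurable_funM => //; exact: measurable_cst.
have mab := measurable_itvR a b.
have H := integrableD mab (integrableZl mab (c ^+ 2) f2)
   (integrableD mab (integrableZl mab (c *+ 2) fg) g2).
apply: eq_integrable H => // s _ /=; congr EFin.
by rewrite mulr2n; ring.
Qed.

Lemma dotE (R : realType) (p : nat) (u v : 'cV[R]_p) :
  dot u v = \sum_i u i 0 * v i 0.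
Proof. by rewrite /dot mxE; apply: eq_bigr => i _; rewrite mxE. Qed.

Lemma dotC (R : realType) (p : nat) (u v : 'cV[R]_p) : dot u v = dot v u.
Proof. by rewrite !dotE; apply: eq_bigr => i _; rewrite mulrC. Qed.

Lemma dotZDl (R : realType) (p : nat) (c : R) (u v w : 'cV[R]_p) :
  dot (c *: u + v) w = c * dot u w + dot v w.
Proof.
rewrite !dotE mulr_sumr -big_split; apply: eq_bigr => i _ /=.
by rewrite !mxE mulrDl mulrA.
Qed.

Lemma dot_ge0 (R : realType) (p : nat) (u : 'cV[R]_p) : 0 <= dot u u.
Proof. by rewrite dotE sumr_ge0// => i _; rewrite -expr2 sqr_ge0. Qed.

Lemma dot_mulmxl (R : realType) (p q : nat) (M : 'M[R]_(q, p)) u v :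
  dot (M *m u) v = dot u (M^T *m v).
Proof. by rewrite /dot trmx_mul mulmxA. Qed.

Section space.
Context (R : realType) (a b : R).
Implicit Types (n : nat * nat).
Local Notation mu := (@lebesgue_measure R).

Lemma measurable_dot p (f g : R -> 'cV[R]_p) (D : set R) :
  (forall i, measurable_fun D (fun s => f s i 0)) ->
  (forall i, measurable_fun D (fun s => g s i 0)) ->
  measurable_fun D (fun s => dot (f s) (g s)).
Proof.
move=> mf mg.
rewrite (_ : (fun s => _) = (fun s => \sum_i f s i 0 * g s i 0)); last first.
  by apply/funext => s; rewrite dotE.
by apply: measurable_sum => i; exact: measurable_funM.
Qed.

Lemma inZP n (z : Zrep R n) :
  inZ a b z <-> forall i, sqint a b (fun s => z.2 s i 0).
Proof.
split=> [[mz zoo] i|H].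
  split => //.
  have mzz := measurable_dot mz mz.
  have izz : mu.-integrable `[a, b] (EFin \o (fun s => dot (z.2 s) (z.2 s))).
    apply/integrableP; split; first exact/measurable_EFinP.
    under eq_integral do rewrite /= ger0_norm ?dot_ge0//.
    exact: zoo.
  apply: le_integrable izz => //.
    by apply/measurable_EFinP; apply: measurable_funX; exact: mz.
  move=> s _; rewrite /= lee_fin.
  rewrite ger0_norm ?sqr_ge0//.
  rewrite [leRHS]ger0_norm ?dot_ge0// dotE.
  rewrite (bigD1 i)//= -expr2 lerDl sumr_ge0// => j _.
  by rewrite -expr2 sqr_ge0.
split; first by move=> i; case: (H i).
have izz : mu.-integrable `[a, b] (fun s => \sum_(i : 'I_n.2) (z.2 s i 0 ^+ 2)%:E)%E.
  by apply: integrable_sum => //= i _; case: (H i).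
have /integrableP[_] := izz.
congr (_ < _)%E; apply: eq_integral => s _.
rewrite sumEFin /= ger0_norm; last by apply: sumr_ge0 => i _; exact: sqr_ge0.
by rewrite dotE; congr EFin; apply: eq_bigr => i _; rewrite expr2.
Qed.

Lemma integrable_dot n (z w : Zrep R n) : inZ a b z -> inZ a b w ->
  mu.-integrable `[a, b] (EFin \o (fun s => dot (z.2 s) (w.2 s))).
Proof.
move=> /inZP Hz /inZP Hw.
have : mu.-integrable `[a, b] (fun s => \sum_(i : 'I_n.2) (z.2 s i 0 * w.2 s i 0)%:E)%E.
  by apply: integrable_sum => //= i _; exact: sqint_mul_integrable.
by apply: eq_integrable => // s _; rewrite sumEFin /= dotE.
Qed.

Lemma inZ_ZD n c (z w : Zrep R n) : inZ a b z -> inZ a b w ->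
  inZ a b (c *: z + w).
Proof.
move=> /inZP Hz /inZP Hw; apply/inZP => i.
rewrite (_ : (fun s => _) = (fun s => c * z.2 s i 0 + w.2 s i 0)).
  exact: sqintZD.
by apply/funext => s; rewrite /= !mxE.
Qed.

Lemma inZ0 n : inZ a b (0 : Zrep R n).
Proof.
apply/inZP => i; rewrite (_ : (fun s => _) = cst 0); first exact: sqint_cst.
by apply/funext => s /=; rewrite mxE.
Qed.

Lemma inZD n (z w : Zrep R n) : inZ a b z -> inZ a b w -> inZ a b (z + w).
Proof. by move=> Hz Hw; rewrite -[z]scale1r; exact: inZ_ZD. Qed.

Lemma inZZ n c (z : Zrep R n) : inZ a b z -> inZ a b (c *: z).
Proof. by move=> Hz; rewrite -[_ *: _]addr0; apply: inZ_ZD => //; exact: inZ0. Qed.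

Lemma inZB n (z w : Zrep R n) : inZ a b z -> inZ a b w -> inZ a b (z - w).
Proof. by move=> Hz Hw; rewrite addrC -scaleN1r; exact: inZ_ZD. Qed.

Lemma inZ_sum n (I : Type) (r : seq I) (F : I -> Zrep R n) :
  (forall i, inZ a b (F i)) -> inZ a b (\sum_(i <- r) F i).
Proof. by move=> HF; apply: big_ind => //; [exact: inZ0|exact: inZD]. Qed.

Local Notation "<< z , w >>" := (innerZ a b z w).

Lemma innerZC n (z w : Zrep R n) : <<z, w>> = <<w, z>>.
Proof.
rewrite /innerZ dotC; congr (_ + _).
by apply: eq_Rintegral => s _; rewrite dotC.
Qed.

Lemma innerZ_ZDl n c (z w y : Zrep R n) : inZ a b z -> inZ a b w ->
  inZ a b y -> <<c *: z + w, y>> = c * <<z, y>> + <<w, y>>.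
Proof.
move=> Hz Hw Hy; rewrite /innerZ dotZDl.
have izy := integrable_dot Hz Hy; have iwy := integrable_dot Hw Hy.
have -> : \int[mu]_(s in `[a, b]) dot ((c *: z + w).2 s) (y.2 s) =
   \int[mu]_(s in `[a, b]) (c * dot (z.2 s) (y.2 s) + dot (w.2 s) (y.2 s)).
  by apply: eq_Rintegral => s _; rewrite -dotZDl.
rewrite RintegralD//; last first.
  by have := integrableZl (measurable_itvR a b) c izy; apply: eq_integrable.
rewrite RintegralZl//; ring.
Qed.

Lemma innerZ0l n (y : Zrep R n) : inZ a b y -> <<0, y>> = 0.
Proof.
move=> Hy; have H0 := inZ0 n.
by have := innerZ_ZDl 1 H0 H0 Hy; rewrite scaler0 addr0 mul1r; lra.
Qed.

Lemma innerZDl n (z w y : Zrep R n) : inZ a b z -> inZ a b w ->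
  inZ a b y -> <<z + w, y>> = <<z, y>> + <<w, y>>.
Proof. by move=> Hz Hw Hy; rewrite -{1}[z]scale1r innerZ_ZDl// mul1r. Qed.

Lemma innerZZl n c (z y : Zrep R n) : inZ a b z ->
  inZ a b y -> <<c *: z, y>> = c * <<z, y>>.
Proof.
move=> Hz Hy; rewrite -[_ *: _]addr0 innerZ_ZDl//; last exact: inZ0.
by rewrite innerZ0l// addr0.
Qed.

Lemma innerZBl n (z w y : Zrep R n) : inZ a b z -> inZ a b w ->
  inZ a b y -> <<z - w, y>> = <<z, y>> - <<w, y>>.
Proof.
by move=> Hz Hw Hy; rewrite addrC -scaleN1r innerZ_ZDl// mulN1r addrC.
Qed.

Lemma innerZ_suml n (I : Type) (r : seq I) (F : I -> Zrep R n) y :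
  (forall i, inZ a b (F i)) -> inZ a b y ->
  <<\sum_(i <- r) F i, y>> = \sum_(i <- r) <<F i, y>>.
Proof.
move=> HF Hy; elim: r => [|i r IH]; first by rewrite !big_nil innerZ0l.
by rewrite !big_cons innerZDl ?IH//; exact: inZ_sum.
Qed.

Lemma innerZDr n (z w y : Zrep R n) : inZ a b z -> inZ a b w ->
  inZ a b y -> <<y, z + w>> = <<y, z>> + <<y, w>>.
Proof. by move=> *; rewrite innerZC innerZDl// !(innerZC _ y). Qed.

Lemma innerZZr n c (z y : Zrep R n) : inZ a b z ->
  inZ a b y -> <<y, c *: z>> = c * <<y, z>>.
Proof. by move=> *; rewrite innerZC innerZZl// (innerZC _ y). Qed.

Lemma innerZ_ge0 n (z : Zrep R n) : 0 <= <<z, z>>.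
Proof.
by rewrite addr_ge0 ?dot_ge0//; apply: Rintegral_ge0 => s _; exact: dot_ge0.
Qed.

Local Notation nrm := (normZ a b).

Lemma normZ_ge0 n (z : Zrep R n) : 0 <= nrm z.
Proof. exact: sqrtr_ge0. Qed.

Lemma normZ_sqr n (z : Zrep R n) : nrm z ^+ 2 = <<z, z>>.
Proof. by rewrite sqr_sqrtr// innerZ_ge0. Qed.

Lemma CauchySchwarzZ n (z w : Zrep R n) : inZ a b z -> inZ a b w ->
  `|<<z, w>>| <= nrm z * nrm w.
Proof.
move=> Hz Hw.
(* The squared norm of [t *: w + z], as a polynomial in [t]. *)
have q t : 0 <= <<z, z>> + t * (2 * <<z, w>>) + t ^+ 2 * <<w, w>>.
  have := innerZ_ge0 (t *: w + z).
  rewrite innerZ_ZDl//; last exact: inZ_ZD.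
  rewrite !(innerZC _ (t *: w + z)) !innerZ_ZDl// (innerZC w z); lra.
rewrite -ler_sqr ?nnegrE ?mulr_ge0 ?normZ_ge0// exprMn !normZ_sqr real_normK ?num_real//.
(* On representatives [innerZ] is only semidefinite. If [<<w, w>>] is positive, [q] is used at its
   minimizer; if it vanishes, [q] is affine in [t] and a nonzero slope would let it take the value
   -1. *)
have [w0|w0] := eqVneq <<w, w>> 0; last first.
  have wgt0 : 0 < <<w, w>> by rewrite lt_neqAle eq_sym w0 innerZ_ge0.
  have := q (- <<z, w>> / <<w, w>>).
  have -> : <<z, z>> + - <<z, w>> / <<w, w>> * (2 * <<z, w>>) +
       (- <<z, w>> / <<w, w>>) ^+ 2 * <<w, w>> =
       (<<z, z>> * <<w, w>> - <<z, w>> ^+ 2) / <<w, w>> by field.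
  by rewrite pmulr_lge0 ?invr_gt0// subr_ge0.
rewrite w0 mulr0; have [->|zw0] := eqVneq <<z, w>> 0; first by rewrite expr0n.
have := q (- (<<z, z>> + 1) / (2 * <<z, w>>)); rewrite w0 mulr0 addr0.
have -> : - (<<z, z>> + 1) / (2 * <<z, w>>) * (2 * <<z, w>>) = - (<<z, z>> + 1).
  by field.
lra.
Qed.

Lemma normZ_triangle n (z w : Zrep R n) : inZ a b z -> inZ a b w ->
  nrm (z + w) <= nrm z + nrm w.
Proof.
move=> Hz Hw; rewrite -ler_sqr ?nnegrE ?addr_ge0 ?normZ_ge0//.
rewrite sqrrD !normZ_sqr; have Hzw := inZD Hz Hw.
rewrite innerZDl// !(innerZC _ (z + w)) !innerZDl// (innerZC w z).
have := le_trans (ler_norm _) (CauchySchwarzZ Hz Hw); lra.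
Qed.

Lemma normZZ n c (z : Zrep R n) : inZ a b z -> nrm (c *: z) = `|c| * nrm z.
Proof.
move=> Hz; apply/eqP; rewrite -(eqrXn2 (n:=2)) ?mulr_ge0 ?normZ_ge0//; apply/eqP.
rewrite exprMn !normZ_sqr innerZZl; [|exact: Hz|exact: inZZ].
rewrite innerZZr; [|exact: Hz|exact: Hz].
by rewrite real_normK ?num_real// expr2 mulrA.
Qed.

Lemma normZN n (z : Zrep R n) : inZ a b z -> nrm (- z) = nrm z.
Proof. by move=> Hz; rewrite -scaleN1r normZZ// normrN1 mul1r. Qed.

Lemma eqZ_normZ0 n (z w : Zrep R n) : eqZ a b z w -> inZ a b z -> inZ a b w ->
  nrm (z - w) = 0.
Proof.
move=> [e1 e2] Hz Hw; rewrite /normZ /innerZ.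
rewrite (_ : (z - w).1 = z.1 - w.1)// e1 subrr.
rewrite (_ : dot 0 0 = 0); last by rewrite dotE big1// => i _; rewrite mxE mul0r.
rewrite add0r (_ : Rintegral _ _ _ = 0) ?sqrtr0//.
have Hzw := inZB Hz Hw.
rewrite /Rintegral (_ : integral _ _ _ = 0%E)//.
rewrite -[RHS](integral0 mu `[a, b]).
apply: ae_eq_integral => //.
  exact: measurable_int (integrable_dot Hzw Hzw).
move: e2; apply: filterS; first exact: (ae_filter_ringOfSetsType mu).
move=> s zw sab; have {}zw := zw sab.
rewrite (_ : (z - w).2 s = z.2 s - w.2 s)// zw subrr.
by rewrite dotE big1// => i _; rewrite mxE mul0r.
Qed.

(** By Cauchy-Schwarz, a zero distance is all that is needed to exchange representatives inside an
    inner product. *)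
Lemma innerZ_eql n (z z' w : Zrep R n) : inZ a b z -> inZ a b z' -> inZ a b w ->
  nrm (z - z') = 0 -> <<z, w>> = <<z', w>>.
Proof.
move=> Hz Hz' Hw e; apply/eqP; rewrite -subr_eq0 -innerZBl// -normr_le0.
by apply: le_trans (CauchySchwarzZ _ _) _ => //; [exact: inZB|rewrite e mul0r].
Qed.

End space.

(** * Exchanging the order of integration on a triangle *)

(** The shape of both inner integrals in [volterra_swap]: with one variable fixed, the kernel is a
    constant times the other function cut off to an interval. *)
Lemma integral_mull_patch (R : realType) (f g : R -> R) (E : set R) (c : R) :
  measurable (E : set (measurableTypeR R)) -> (@lebesgue_measure R).-integrable E (EFin \o g) ->
  (forall y, f y = c * (g \_ E) y) ->
  (\int[@lebesgue_measure R]_y (f y)%:E =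
   (c * \int[@lebesgue_measure R]_(y in E) g y)%:E)%E.
Proof.
move=> mE ig fE.
under eq_integral do rewrite fE EFinM.
have ige : (@lebesgue_measure R).-integrable setT (EFin \o (g \_ E)).
  by rewrite -restrict_EFin; apply/integrable_restrict => //; rewrite setTI.
rewrite integralZl// EFinM /Rintegral fineK; last exact: integrable_fin_num.
by rewrite [in RHS]integral_mkcond restrict_EFin.
Qed.

Lemma volterra_swap (R : realType) (a b : R) (f g : R -> R) :
  (@lebesgue_measure R).-integrable `[a, b] (EFin \o f) ->
  (@lebesgue_measure R).-integrable `[a, b] (EFin \o g) ->
  \int[@lebesgue_measure R]_(s in `[a, b])
    (\int[@lebesgue_measure R]_(t in `[a, s]) f t * g s) =
  \int[@lebesgue_measure R]_(t in `[a, b])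
    (f t * \int[@lebesgue_measure R]_(s in `[t, b]) g s).
Proof.
move=> if_ ig; set mu := @lebesgue_measure R.
have mab := measurable_itvR a b.
pose fe : measurableTypeR R -> R := f \_ `[a, b].
pose ge : measurableTypeR R -> R := g \_ `[a, b].
have ife : mu.-integrable setT (EFin \o fe).
  by rewrite -restrict_EFin; apply/integrable_restrict => //; rewrite setTI.
have ige : mu.-integrable setT (EFin \o ge).
  by rewrite -restrict_EFin; apply/integrable_restrict => //; rewrite setTI.
have mfe : measurable_fun setT fe by apply/measurable_EFinP; exact: measurable_int ife.
have mge : measurable_fun setT ge by apply/measurable_EFinP; exact: measurable_int ige.
pose L : set (measurableTypeR R * measurableTypeR R) := [set p | p.1 <= p.2].
have mL : measurable L.
  have mle := @measurable_fun_ler _ _ R setT (fun p : measurableTypeR R * measurableTypeR R => p.1)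
    (fun p => p.2) measurable_fst measurable_snd.
  by have := mle measurableT [set true] I; rewrite setTI; congr measurable; apply/seteqP; split.
(* The cut-offs and the indicator of [L] put the triangle into the integrand, so that Fubini applies
   on the whole plane; [p.1] plays the role of [t] and [p.2] that of [s]. *)
pose k (p : measurableTypeR R * measurableTypeR R) : R := fe p.1 * ge p.2 * \1_L p.
have mk : measurable_fun setT (EFin \o k).
  apply/measurable_EFinP; apply: measurable_funM; last exact: measurable_indic.
  by apply: measurable_funM; [exact: (measurableT_comp mfe measurable_fst)|
                              exact: (measurableT_comp mge measurable_snd)].
have inL x y : ((x, y) \in L) = (x <= y).
  by apply/idP/idP => [/set_mem|xy]; [|apply/mem_set].
have kx x : (\int[mu]_y (k (x, y))%:E =
    (((fun t => f t * \int[mu]_(s in `[t, b]) g s) \_ `[a, b]) x)%:E)%E.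
  rewrite patchE; case: ifPn => xD; last first.
    rewrite integral0_eq// => y _; rewrite /k /fe /= patchE (negbTE xD).
    by rewrite /= !mul0r.
  move: (xD); rewrite inE/= in_itv/= => /andP[ax xb].
  apply: (@integral_mull_patch R (fun y => k (x, y)) g `[x, b] (f x)).
  - exact: measurable_itvR.
  -
 apply: integrableS ig => //.
    by apply: subset_itvr; rewrite bnd_simp.
  move=> y; rewrite /k /fe /ge /= !patchE xD -mulrA; congr (_ * _).
  rewrite indicE inL !mem_setE !in_itv/=.
  have [xy|yx] := leP x y; last by rewrite mulr0.
  by rewrite (le_trans ax xy)/= mulr1.
have ky y : (\int[mu]_x (k (x, y))%:E =
    (((fun s => \int[mu]_(t in `[a, s]) f t * g s) \_ `[a, b]) y)%:E)%E.
  rewrite patchE; case: ifPn => yD; last first.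
    rewrite integral0_eq// => x _; rewrite /k /ge /= patchE (negbTE yD).
    by rewrite /= mulr0 mul0r.
  move: (yD); rewrite inE/= in_itv/= => /andP[ay yb].
  rewrite [in RHS]mulrC.
  apply: (@integral_mull_patch R (fun x => k (x, y)) f `[a, y] (g y)).
  - exact: measurable_itvR.
  - apply: integrableS if_ => //.
    by apply: subset_itvl; rewrite bnd_simp.
  move=> x; rewrite /k /fe /ge /= !patchE yD -mulrA mulrCA; congr (_ * _).
  rewrite indicE inL !mem_setE !in_itv/=.
  have [xy|yx] := leP x y; last by rewrite andbF mulr0.
  by rewrite (le_trans xy yb)/= mulr1.
(* [k] is dominated by [|fe x| * |ge y|], whose iterated integral is a product of two finite
   integrals. *)
have ik : (mu \x mu)%E.-integrable setT (EFin \o k).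
  apply/integrable12ltyP => //.
  have ia : mu.-integrable setT (fun x => (\int[mu]_y `|ge y|)%:E * `|(fe x)%:E|)%E.
    by apply: integrableZl => //; exact: integrable_abse.
  have /integrableP[_] := ia; apply: le_lt_trans.
  apply: ge0_le_integral => //.
  - by move=> x _; exact: integral_ge0.
  - apply: (measurable_fun_fubini_tonelli_F (abse \o (EFin \o k))) => //=.
    exact: measurableT_comp.
  - by apply: measurableT_comp => //; exact: measurable_int ia.
  move=> x _.
  rewrite gee0_abs; last by rewrite mule_ge0// lee_fin Rintegral_ge0.
  rewrite muleC /Rintegral fineK; last first.
    by apply: integrable_fin_num => //; exact: integrable_norm.
  rewrite -ge0_integralZl//; last first.
    by apply/measurable_EFinP; exact: measurableT_comp.
  apply: ge0_le_integral => //.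
  - apply: measurableT_comp => //.
    by apply: (measurableT_comp mk (measurable_pair1 x)).
  - apply: measurable_funeM; apply/measurable_EFinP; exact: measurableT_comp.
  move=> y _; rewrite /= lee_fin /k /= !normrM.
  rewrite -[leRHS]mulr1 ler_wpM2l ?mulr_ge0//.
  by rewrite indicE; case: (_ \in _); rewrite ?normr1 ?normr0.
have := Fubini ik.
under eq_integral do rewrite /= kx.
under [in X in _ = X -> _]eq_integral do rewrite /= ky.
by rewrite (Rintegral_mkcond mu `[a, b]) (Rintegral_mkcond mu `[a, b]) /Rintegral => ->.
Qed.

(** * Adjointable operators *)

Lemma Rintegral_sum d (T : measurableType d) (R : realType)
    (mu : {measure set T -> \bar R}) (D : set T) (I : Type) (r : seq I)
    (F : I -> T -> R) : measurable D ->
  (forall i, mu.-integrable D (EFin \o F i)) ->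
  \int[mu]_(x in D) (\sum_(i <- r) F i x) =
  \sum_(i <- r) \int[mu]_(x in D) F i x.
Proof.
move=> mD iF; elim: r => [|i r IH].
  rewrite big_nil (_ : (fun x => _) = cst 0); first by rewrite Rintegral_cst// mul0r.
  by apply/funext => x; rewrite big_nil.
rewrite big_cons -IH -RintegralD//; last first.
  have : mu.-integrable D (fun x => \sum_(i <- r) (F i x)%:E)%E.
    by apply: integrable_sum => // j _; exact: iF.
  by apply: eq_integrable => // x _; rewrite sumEFin.
by apply: eq_Rintegral => x _; rewrite big_cons.
Qed.

Section operators.
Context (R : realType) (a b : R).
Hypothesis hab : a < b.
Local Notation mu := (@lebesgue_measure R).
Local Notation "<< z , w >>" := (innerZ a b z w).
Local Notation nrm := (normZ a b).

Lemma lebesgue_measure_ab : fine (mu `[a, b]) = b - a.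
Proof. by rewrite lebesgue_measure_itv/= lte_fin hab -EFinD. Qed.

Lemma sqr_Rintegral_norm_le (f : R -> R) : sqint a b f ->
  (\int[mu]_(s in `[a, b]) `|f s|) ^+ 2 <=
  (b - a) * \int[mu]_(s in `[a, b]) (f s ^+ 2).
Proof.
move=> sf; have iff := sqint_integrable sf; have [mf f2] := sf.
have mab := measurable_itvR a b.
set J := \int[mu]_(s in _) `|f s|; set J2 := Rintegral _ _ _.
have ba : 0 < b - a by rewrite subr_gt0.
(* The claim is that the integral of (|f| - c)^2 is nonnegative for c the mean of |f|. *)
set c := J / (b - a).
have inf := integrable_norm iff.
have ic : mu.-integrable `[a, b] (EFin \o cst (c ^+ 2)).
  exact: sqint_integrable (sqint_cst a b (c ^+ 2)).
have icn : mu.-integrable `[a, b] (EFin \o (fun s => - (2 * c) * `|f s|)).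
  by have := integrableZl mab (- (2 * c)) inf; apply: eq_integrable.
have icn2 : mu.-integrable `[a, b] (EFin \o (fun s => f s ^+ 2 + - (2 * c) * `|f s|)).
  by have := integrableD mab f2 icn; apply: eq_integrable.
have : 0 <= \int[mu]_(s in `[a, b]) (f s ^+ 2 + - (2 * c) * `|f s| + c ^+ 2).
  apply: Rintegral_ge0 => s _.
  have := sqr_ge0 (`|f s| - c); rewrite sqrrB real_normK ?num_real//; lra.
rewrite RintegralD// RintegralD// RintegralZl// Rintegral_cst// lebesgue_measure_ab.
rewrite -/J -/J2 => H.
rewrite -subr_ge0.
have -> : (b - a) * J2 - J ^+ 2 = (b - a) * (J2 + - (2 * c) * J + c ^+ 2 * (b - a)).
  by rewrite /c; field; lra.
by rewrite mulr_ge0// ltW.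
Qed.

Lemma Rintegral_sqr_le_innerZ n (z : Zrep R n) (j : 'I_n.2) : inZ a b z ->
  \int[mu]_(s in `[a, b]) (z.2 s j 0 ^+ 2) <= <<z, z>>.
Proof.
move=> Hz; rewrite /innerZ -[leLHS]add0r lerD ?dot_ge0//.
apply: le_Rintegral; [exact: measurable_itvR| |exact: integrable_dot|].
  by have /inZP/(_ j)[] := Hz.
move=> s _; rewrite dotE (bigD1 j)//= -expr2 lerDl sumr_ge0// => i _.
by rewrite -expr2 sqr_ge0.
Qed.

(** With absolute values inside, [E] may be enlarged to [a, b]. The bound is thus uniform in [E], as
    the Volterra operators require, their domain of integration moving with [s]. *)
Lemma sqr_Rintegral_sub_le n (z : Zrep R n) (j : 'I_n.2) (E : set R) :
  inZ a b z -> measurable (E : set (measurableTypeR R)) -> E `<=` `[a, b] ->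
  (\int[mu]_(s in E) z.2 s j 0) ^+ 2 <= (b - a) * <<z, z>>.
Proof.
move=> Hz mE Eab; have /inZP/(_ j) sz := Hz.
have iz := sqint_integrable sz.
have mab := measurable_itvR a b.
have izE : mu.-integrable E (EFin \o (fun s => z.2 s j 0)).
  exact: integrableS iz.
apply: (@le_trans _ _ ((\int[mu]_(s in `[a, b]) `|z.2 s j 0|) ^+ 2)).
  rewrite -[leLHS]real_normK ?num_real// ler_sqr ?nnegrE ?Rintegral_ge0//.
  apply: le_trans (le_normr_Rintegral mE izE) _.
  have inz := integrable_norm iz; have inzE := integrable_norm izE.
  rewrite -lee_fin /Rintegral !fineK; try exact: integrable_fin_num.
  apply: ge0_subset_integral => //; exact: measurable_int inz.
apply: le_trans (sqr_Rintegral_norm_le sz) _.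
by apply: ler_wpM2l; [rewrite subr_ge0 ltW|exact: Rintegral_sqr_le_innerZ].
Qed.

Lemma dot_le p (u : 'cV[R]_p) (M : R) : (forall i, u i 0 ^+ 2 <= M) ->
  dot u u <= p%:R * M.
Proof.
move=> uM; rewrite dotE mulr_natl -[p in M *+ p]card_ord -sumr_const.
by apply: ler_sum => i _; rewrite -expr2.
Qed.

(** Every entry of [u] is at most its norm [d], so each of the [q] entries of the product is at most
    [p M d]. *)
Lemma dot_mulmx_le p q (F : 'M[R]_(q, p)) (u : 'cV[R]_p) (M : R) :
  (forall i j, `|F i j| <= M) ->
  dot (F *m u) (F *m u) <= q%:R * (p%:R * M) ^+ 2 * dot u u.
Proof.
move=> FM; rewrite -mulrA; apply: dot_le => i.
set d := Num.sqrt (dot u u).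
have -> : dot u u = d ^+ 2 by rewrite sqr_sqrtr ?dot_ge0.
have ud j : `|u j 0| <= d.
  rewrite -sqrtr_sqr ler_sqrt ?dot_ge0// dotE (bigD1 j)//= expr2 lerDl.
  by rewrite sumr_ge0// => k _; rewrite -expr2 sqr_ge0.
have d0 : 0 <= d by exact: sqrtr_ge0.
rewrite -exprMn -[leLHS]real_normK ?num_real// ler_sqr ?nnegrE//; last first.
  (* The sign of [M] is known only from an entry of [F], which requires [p] to be positive. *)
  have [->|/eqP/eqP] := eqVneq p 0%N; first by rewrite !mul0r.
  rewrite -lt0n => p0; rewrite !mulr_ge0//.
  by apply: le_trans (FM i (Ordinal p0)).
rewrite mxE; apply: le_trans (ler_norm_sum _ _ _) _.
rewrite -mulrA mulr_natl -[p in _ *+ p]card_ord -sumr_const.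
by apply: ler_sum => j _; rewrite normrM ler_pM.
Qed.

(** The bound is recorded for [K] alone, since [adjoint_pair_sym] transfers it to [K']. Linearity is
    not a clause: the exchange identity already gives it inside inner products, see
    [adjointable_ZDl]. *)
Definition adjoint_pair n m (K : Zrep R n -> Zrep R m) (K' : Zrep R m -> Zrep R n) :=
  [/\ forall z, inZ a b z -> inZ a b (K z),
      forall w, inZ a b w -> inZ a b (K' w),
      forall z w, inZ a b z -> inZ a b w -> <<K z, w>> = <<z, K' w>> &
      exists2 M : R, 0 <= M & forall z, inZ a b z -> nrm (K z) <= M * nrm z].

Definition adjointable n m (K : Zrep R n -> Zrep R m) :=
  exists K', adjoint_pair K K'.

Lemma inZ_ext n (z w : Zrep R n) : (forall s, s \in `[a, b] -> z.2 s = w.2 s) ->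
  inZ a b z -> inZ a b w.
Proof.
move=> zw /inZP Hz; apply/inZP => i; have [mz z2] := Hz i; split.
  apply: eq_measurable_fun mz => s; rewrite inE/= => sab; by rewrite zw.
apply: eq_integrable z2 => //.
by move=> s; rewrite inE/= => sab; rewrite zw.
Qed.

Lemma innerZ_ext n (z z' w w' : Zrep R n) : z.1 = z'.1 ->
  (forall s, s \in `[a, b] -> z.2 s = z'.2 s) -> w.1 = w'.1 ->
  (forall s, s \in `[a, b] -> w.2 s = w'.2 s) -> <<z, w>> = <<z', w'>>.
Proof.
move=> z1 z2 w1 w2; rewrite /innerZ z1 w1; congr (_ + _).
by apply: eq_Rintegral => s; rewrite inE/= => sab; rewrite z2// w2.
Qed.

(** Needed because a separable kernel coincides with its finite sum only for arguments in [a, b]. *)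
Lemma adjointable_ext n m (K L : Zrep R n -> Zrep R m) :
  (forall z, inZ a b z -> (K z).1 = (L z).1 /\
     forall s, s \in `[a, b] -> (K z).2 s = (L z).2 s) ->
  adjointable K -> adjointable L.
Proof.
move=> KL [K' [H1 H2 H3 [M M0 HM]]]; exists K'; split => //.
- by move=> z Hz; have [_ k2] := KL z Hz; apply: inZ_ext (H1 _ Hz).
- move=> z w Hz Hw; rewrite -H3//; have [k1 k2] := KL z Hz.
  by apply: innerZ_ext => // s sab; rewrite k2.
- exists M => // z Hz; apply: le_trans (HM z Hz); have [k1 k2] := KL z Hz.
  by rewrite /normZ (innerZ_ext k1 k2 k1 k2).
Qed.

Lemma adjointable0 n m : adjointable (fun _ : Zrep R n => 0 : Zrep R m).
Proof.
exists (fun=> 0); split => //; try by move=> *; exact: inZ0.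
  by move=> z w Hz Hw; rewrite innerZ0l// innerZC innerZ0l.
exists 0 => // z _; rewrite mul0r /normZ innerZ0l ?sqrtr0//; exact: inZ0.
Qed.

Lemma adjointableD n m (K L : Zrep R n -> Zrep R m) :
  adjointable K -> adjointable L -> adjointable (fun z => K z + L z).
Proof.
move=> [K' [k1 k2 k3 [M M0 kM]]] [L' [l1 l2 l3 [N N0 lN]]].
exists (fun w => K' w + L' w); split.
- by move=> z Hz; apply: inZD; [exact: k1|exact: l1].
- by move=> z Hz; apply: inZD; [exact: k2|exact: l2].
- move=> z w Hz Hw; have kz := k1 z Hz; have lz := l1 z Hz.
  have kw := k2 w Hw; have lw := l2 w Hw.
  by rewrite innerZDl// innerZDr// k3// l3.
- exists (M + N); first exact: addr_ge0.
  move=> z Hz; rewrite mulrDl; apply: le_trans (lerD (kM z Hz) (lN z Hz)).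
  by apply: normZ_triangle; [exact: k1|exact: l1].
Qed.

Lemma adjointable_sum n m (I : Type) (r : seq I) (K : I -> Zrep R n -> Zrep R m) :
  (forall i, adjointable (K i)) -> adjointable (fun z => \sum_(i <- r) K i z).
Proof.
move=> HK; elim: r => [|i r IH].
  rewrite (_ : (fun z => _) = fun=> 0); first exact: adjointable0.
  by apply/funext => z; rewrite big_nil.
rewrite (_ : (fun z => _) = fun z => K i z + \sum_(i <- r) K i z).
  exact: adjointableD.
by apply/funext => z; rewrite big_cons.
Qed.

Lemma adjointable_comp n m l (K : Zrep R n -> Zrep R m) (L : Zrep R m -> Zrep R l) :
  adjointable K -> adjointable L -> adjointable (L \o K).
Proof.
move=> [K' [k1 k2 k3 [M M0 kM]]] [L' [l1 l2 l3 [N N0 lN]]].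
exists (K' \o L'); split => /=.
- by move=> z Hz; apply: l1; exact: k1.
- by move=> z Hz; apply: k2; exact: l2.
- by move=> z w Hz Hw; rewrite l3 ?k3//; [exact: l2|exact: k1].
- exists (N * M); first exact: mulr_ge0.
  move=> z Hz; apply: le_trans (lN _ (k1 _ Hz)) _.
  by rewrite -mulrA ler_wpM2l// kM.
Qed.

Lemma normZ_le n m (z : Zrep R n) (w : Zrep R m) (M : R) : 0 <= M ->
  <<w, w>> <= M * <<z, z>> -> nrm w <= Num.sqrt M * nrm z.
Proof. by move=> M0 wz; rewrite /normZ -sqrtrM// ler_wsqrtr. Qed.

Definition inl_Z n1 n2 (x : 'cV[R]_n1) : Zrep R (n1, n2) := (x, fun=> 0).
Definition inr_Z n1 n2 (f : R -> 'cV[R]_n2) : Zrep R (n1, n2) := (0, f).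

Lemma dot0l p (u : 'cV[R]_p) : dot 0 u = 0.
Proof. by rewrite dotE big1// => i _; rewrite mxE mul0r. Qed.

Lemma inZ_inl n1 n2 (x : 'cV[R]_n1) : inZ a b (inl_Z n2 x).
Proof.
apply/inZP => i /=; rewrite (_ : (fun s => _) = cst 0); first exact: sqint_cst.
by apply/funext => s /=; rewrite mxE.
Qed.

Lemma innerZ_inl n1 n2 (x : 'cV[R]_n1) (w : Zrep R (n1, n2)) :
  <<inl_Z n2 x, w>> = dot x w.1.
Proof.
rewrite /innerZ /= (_ : Rintegral _ _ _ = 0) ?addr0// -[RHS](mul0r (fine (mu `[a, b]))).
rewrite -Rintegral_cst; last exact: measurable_itvR.
by apply: eq_Rintegral => s _; rewrite dot0l.
Qed.

Lemma innerZ_inr n1 n2 f (w : Zrep R (n1, n2)) :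
  <<inr_Z n1 f, w>> = \int[mu]_(s in `[a, b]) dot (f s) (w.2 s).
Proof. by rewrite /innerZ /= dot0l add0r. Qed.

Lemma dot1_le_innerZ n (z : Zrep R n) : dot z.1 z.1 <= <<z, z>>.
Proof. by rewrite lerDl Rintegral_ge0// => s _; exact: dot_ge0. Qed.

Lemma int2_le_innerZ n (z : Zrep R n) :
  \int[mu]_(s in `[a, b]) dot (z.2 s) (z.2 s) <= <<z, z>>.
Proof. by rewrite lerDr dot_ge0. Qed.

Lemma adjointable_mx p1 p2 q1 q2 (P : 'M[R]_(q1, p1)) :
  adjointable (fun z : Zrep R (p1, p2) => inl_Z q2 (P *m z.1)).
Proof.
exists (fun w => inl_Z p2 (P^T *m w.1)); split.
- by move=> z _; exact: inZ_inl.
- by move=> z _; exact: inZ_inl.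
- by move=> z w _ _; rewrite innerZ_inl [RHS]innerZC innerZ_inl dot_mulmxl dotC.
pose M := \sum_i \sum_j `|P i j|.
have PM i j : `|P i j| <= M.
  rewrite /M (bigD1 i)//= (bigD1 j)//= -addrA lerDl addr_ge0//.
    by apply: sumr_ge0.
  by apply: sumr_ge0 => k _; apply: sumr_ge0.
exists (Num.sqrt (q1%:R * (p1%:R * M) ^+ 2)); first exact: sqrtr_ge0.
move=> z _; have c0 : 0 <= q1%:R * (p1%:R * M) ^+ 2 by rewrite mulr_ge0 ?sqr_ge0.
apply: normZ_le => //; rewrite innerZ_inl.
by apply: le_trans (dot_mulmx_le _ PM) _; apply: ler_wpM2l => //; exact: (@dot1_le_innerZ (p1, p2) z).
Qed.

Lemma bounded_meas_tr p q (F : R -> 'M[R]_(p, q)) :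
  bounded_meas a b F -> bounded_meas a b (fun s => (F s)^T).
Proof.
move=> [mF [M FM]]; split.
  move=> i j; rewrite (_ : (fun s => _) = fun s => F s j i)//.
  by apply/funext => s; rewrite mxE.
by exists M => s sab i j; rewrite mxE; exact: FM.
Qed.

Lemma inZ_mul p1 p2 q1 q2 (F : R -> 'M[R]_(q2, p2)) (z : Zrep R (p1, p2)) :
  bounded_meas a b F -> inZ a b z -> inZ a b (inr_Z q1 (fun s => F s *m z.2 s)).
Proof.
move=> [mF [M FM]] /inZP Hz; apply/inZP => i /=.
rewrite (_ : (fun s => _) = fun s => \sum_(j <- index_enum 'I_p2) F s i j * z.2 s j 0).
  elim: (index_enum _) => [|j r IH].
    rewrite (_ : (fun s => _) = cst 0); first exact: sqint_cst.
    by apply/funext => s; rewrite big_nil.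
  rewrite (_ : (fun s => _) =
    fun s => 1 * (F s i j * z.2 s j 0) + \sum_(j <- r) F s i j * z.2 s j 0); last first.
    by apply/funext => s; rewrite big_cons mul1r.
  apply: sqintZD => //; apply: (sqint_dominated (M := M)) (Hz j) _.
    by apply: measurable_funM; [exact: mF|by case: (Hz j)].
  by move=> s sab; rewrite normrM ler_wpM2r// FM.
by apply/funext => s; rewrite mxE.
Qed.

Lemma adjointable_mul p1 p2 q1 q2 (F : R -> 'M[R]_(q2, p2)) :
  bounded_meas a b F ->
  adjointable (fun z : Zrep R (p1, p2) => inr_Z q1 (fun s => F s *m z.2 s)).
Proof.
move=> bF; exists (fun w => inr_Z p1 (fun s => (F s)^T *m w.2 s)); split.
- by move=> z Hz; exact: inZ_mul.
- by move=> z Hz; apply: inZ_mul => //; exact: bounded_meas_tr.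
- move=> z w _ _; rewrite innerZ_inr [RHS]innerZC innerZ_inr.
  by apply: eq_Rintegral => s _; rewrite dot_mulmxl dotC.
have mab := measurable_itvR a b.
have [mF [M FM]] := bF.
have c0 : 0 <= q2%:R * (p2%:R * M) ^+ 2 by rewrite mulr_ge0 ?sqr_ge0.
exists (Num.sqrt (q2%:R * (p2%:R * M) ^+ 2)); first exact: sqrtr_ge0.
move=> z Hz; apply: normZ_le => //; rewrite innerZ_inr.
apply: le_trans (ler_wpM2l c0 (@int2_le_innerZ (p1, p2) z)).
have izz := integrable_dot Hz Hz.
rewrite -RintegralZl//.
have HFz := inZ_mul q1 bF Hz.
apply: le_Rintegral => //.
- exact: (integrable_dot HFz HFz).
- by have := integrableZl mab (q2%:R * (p2%:R * M) ^+ 2) izz; apply: eq_integrable.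
- by move=> s sab; apply: dot_mulmx_le => i j; exact: FM.
Qed.

End operators.

(** * PI operators *)

Section PIoperators.
Context (R : realType) (a b : R).
Hypothesis hab : a < b.
Local Notation mu := (@lebesgue_measure R).
Local Notation "<< z , w >>" := (innerZ a b z w).
Local Notation nrm := (normZ a b).

(** The squared norm of [K' w] equals [<<K (K' w), w>>], hence is at most [M] times the norms of
    [K' w] and [w]; dividing by the norm of [K' w] gives the same bound for [K']. *)
Lemma adjoint_pair_sym n m (K : Zrep R n -> Zrep R m) (K' : Zrep R m -> Zrep R n) :
  adjoint_pair a b K K' -> adjoint_pair a b K' K.
Proof.
move=> [k1 k2 k3 [M M0 kM]]; split => //.
  by move=> w z Hw Hz; rewrite innerZC -k3// innerZC.
exists M => // w Hw; have Kw := k2 w Hw.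
have [->|n0] := eqVneq (nrm (K' w)) 0; first by rewrite mulr_ge0 ?normZ_ge0.
have ngt0 : 0 < nrm (K' w) by rewrite lt_neqAle eq_sym n0 normZ_ge0.
rewrite -(ler_pM2l ngt0) -expr2 normZ_sqr -k3//.
apply: le_trans (ler_norm _) _; apply: le_trans (CauchySchwarzZ (k1 _ Kw) Hw) _.
by rewrite mulrA ler_wpM2r ?normZ_ge0// mulrC kM.
Qed.

Lemma dot_vint n (z : Zrep R n) (u : 'cV[R]_n.2) : inZ a b z ->
  dot (vint `[a, b] z.2) u = \int[mu]_(s in `[a, b]) dot (z.2 s) u.
Proof.
move=> /inZP Hz; rewrite dotE.
under [RHS]eq_Rintegral do rewrite dotE.
have mab := measurable_itvR a b.
rewrite Rintegral_sum//; last first.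
  move=> i; have iz := sqint_integrable (Hz i).
  by have := integrableZl mab (u i 0) iz; apply: eq_integrable => // s _ /=; rewrite mulrC.
apply: eq_bigr => i _; rewrite mxE RintegralZr//; exact: sqint_integrable (Hz i).
Qed.

Lemma inZ_cst n1 n2 (x : 'cV[R]_n2) : inZ a b (inr_Z n1 (fun=> x)).
Proof. by apply/inZP => i; exact: (sqint_cst a b (x i 0)). Qed.

Lemma adjoint_pair_int p1 d q2 : adjoint_pair a b
  (fun z : Zrep R (p1, d) => inl_Z q2 (vint `[a, b] z.2))
  (fun w : Zrep R (d, q2) => inr_Z p1 (fun=> w.1)).
Proof.
split.
- by move=> z _; exact: inZ_inl.
- by move=> w _; exact: inZ_cst.
- move=> z w Hz Hw; rewrite innerZ_inl (@dot_vint (p1, d))// [RHS]innerZC innerZ_inr.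
  by apply: eq_Rintegral => s _; rewrite dotC.
(* Each of the [d] components of the integral has square at most [(b - a) * <<z, z>>]. *)
have c0 : 0 <= d%:R * (b - a) by rewrite mulr_ge0// subr_ge0 ltW.
exists (Num.sqrt (d%:R * (b - a))); first exact: sqrtr_ge0.
move=> z Hz; apply: normZ_le => //; rewrite innerZ_inl /= -mulrA.
apply: dot_le => i; rewrite mxE.
by apply: (@sqr_Rintegral_sub_le _ _ _ hab (p1, d)) => //; exact: measurable_itvR.
Qed.

(** A primitive of an integrable function is continuous. *)
Lemma measurable_volterra_l (f : R -> R) :
  mu.-integrable `[a, b] (EFin \o f) ->
  measurable_fun `[a, b] (fun s => \int[mu]_(t in `[a, s]) f t).
Proof.
move=> iff; have := parameterized_integral_continuous (ltW hab) iff.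
by move/subspace_continuous_measurable_fun; apply; exact: measurable_itvR.
Qed.

Lemma measurable_volterra_r (f : R -> R) :
  mu.-integrable `[a, b] (EFin \o f) ->
  measurable_fun `[a, b] (fun s => \int[mu]_(t in `[s, b]) f t).
Proof.
move=> iff; have mv := measurable_volterra_l iff.
have : measurable_fun `[a, b] (fun s => \int[mu]_(t in `[a, b]) f t - \int[mu]_(t in `[a, s]) f t).
  by apply: measurable_funB => //; exact: measurable_cst.
apply: eq_measurable_fun => s; rewrite inE/= in_itv/= => /andP[as_ sb].
rewrite Rintegral_itvB ?bnd_simp// Rintegral_itv_obnd_cbnd//.
apply: integrableS iff => //.
by apply: subset_itv; rewrite bnd_simp.
Qed.

(** Each component is bounded on [a, b], uniformly in [s], and bounded measurable functions on a
    bounded interval are square-integrable. *)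
Lemma inZ_volterra n1 d q1 (z : Zrep R (n1, d)) (E : R -> set R) :
  inZ a b z ->
  (forall s, s \in `[a, b] -> measurable (E s : set (measurableTypeR R)) /\ E s `<=` `[a, b]) ->
  (forall j, measurable_fun `[a, b] (fun s => \int[mu]_(t in E s) z.2 t j 0)) ->
  inZ a b (inr_Z q1 (fun s => vint (E s) z.2)).
Proof.
move=> Hz EP mE; apply/inZP => j /=.
rewrite (_ : (fun s => _) = fun s => \int[mu]_(t in E s) z.2 t j 0); last first.
  by apply/funext => s; rewrite mxE.
apply: (sqint_dominated (M := Num.sqrt ((b - a) * <<z, z>>))) (sqint_cst a b 1) _ => //.
move=> s sab; have [mEs Es] := EP s sab.
have c0 : 0 <= (b - a) * <<z, z>> by rewrite mulr_ge0 ?innerZ_ge0// subr_ge0 ltW.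
rewrite normr1 mulr1 -sqrtr_sqr ler_wsqrtr//.
exact: (@sqr_Rintegral_sub_le _ _ _ hab (n1, d)).
Qed.

Lemma subset_itv_l s : s \in `[a, b] -> `[a, s] `<=` `[a, b].
Proof. by rewrite in_itv/= => /andP[_ sb]; apply: subset_itvl; rewrite bnd_simp. Qed.

Lemma subset_itv_r s : s \in `[a, b] -> `[s, b] `<=` `[a, b].
Proof. by rewrite in_itv/= => /andP[sa _]; apply: subset_itvr; rewrite bnd_simp. Qed.

Lemma adjoint_pair_volterra p1 q1 d : adjoint_pair a b
  (fun z : Zrep R (p1, d) => inr_Z q1 (fun s => vint `[a, s] z.2))
  (fun w : Zrep R (q1, d) => inr_Z p1 (fun s => vint `[s, b] w.2)).
Proof.
have mab := measurable_itvR a b.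
(* The sizes of the finite-dimensional parts are left free because [z] and [w] carry them in
   opposite order. *)
have H1 p1' q1' (z : Zrep R (p1', d)) : inZ a b z ->
    inZ a b (inr_Z q1' (fun s => vint `[a, s] z.2)).
  move=> Hz; apply: inZ_volterra => //.
    by move=> s sab; split; [exact: measurable_itvR|exact: subset_itv_l].
  by move=> j; apply: measurable_volterra_l; move/inZP : Hz => /(_ j)/sqint_integrable.
have H2 p1' q1' (z : Zrep R (p1', d)) : inZ a b z ->
    inZ a b (inr_Z q1' (fun s => vint `[s, b] z.2)).
  move=> Hz; apply: inZ_volterra => //.
    by move=> s sab; split; [exact: measurable_itvR|exact: subset_itv_r].
  by move=> j; apply: measurable_volterra_r; move/inZP : Hz => /(_ j)/sqint_integrable.
split.
- by move=> z; exact: H1.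
- by move=> z; exact: H2.
- move=> z w Hz Hw; rewrite innerZ_inr [RHS]innerZC innerZ_inr.
  have /inZP Hz' := Hz; have /inZP Hw' := Hw.
  have /inZP Vz := H1 _ q1 _ Hz; have /inZP Vw := H2 _ p1 _ Hw.
  under eq_Rintegral do rewrite dotE.
  under [RHS]eq_Rintegral do rewrite dotE.
  rewrite !Rintegral_sum//; last 2 first.
  + by move=> i; exact: sqint_mul_integrable (Vw i) (Hz' i).
  + by move=> i; exact: sqint_mul_integrable (Vz i) (Hw' i).
  apply: eq_bigr => i _.
  under eq_Rintegral do rewrite mxE.
  rewrite volterra_swap; [|exact: sqint_integrable|exact: sqint_integrable].
  by apply: eq_Rintegral => s _; rewrite mxE mulrC.
(* Pointwise the squared length is at most [d * ((b - a) * <<z, z>>)]; integrating over [a, b]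
   contributes the other factor [b - a]. *)
have c0 : 0 <= (b - a) * d%:R * (b - a) by rewrite !mulr_ge0// subr_ge0 ltW.
exists (Num.sqrt ((b - a) * d%:R * (b - a))); first exact: sqrtr_ge0.
move=> z Hz; apply: normZ_le => //; rewrite innerZ_inr /=.
have HV := H1 _ q1 _ Hz.
apply: (@le_trans _ _ (\int[mu]_(s in `[a, b]) (d%:R * ((b - a) * <<z, z>>)))).
  apply: le_Rintegral => //.
  - exact: (integrable_dot HV HV).
  - exact: sqint_integrable (sqint_cst a b _).
  move=> s sab; apply: dot_le => j; rewrite mxE.
  apply: (@sqr_Rintegral_sub_le _ _ _ hab (p1, d)) => //.
  exact: subset_itv_l.
by rewrite Rintegral_cst// lebesgue_measure_ab//; rewrite le_eqVlt; apply/orP; left; apply/eqP; ring.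
Qed.

Lemma sumZ1 n (I : Type) (r : seq I) (F : I -> Zrep R n) :
  (\sum_(i <- r) F i).1 = \sum_(i <- r) (F i).1.
Proof. by elim/big_rec2: _ => // i x y _ <-. Qed.

Lemma sumZ2 n (I : Type) (r : seq I) (F : I -> Zrep R n) s :
  (\sum_(i <- r) F i).2 s = \sum_(i <- r) (F i).2 s.
Proof. by elim/big_rec2: _ => // i x y _ <-. Qed.

(** Separability is used here: the factor depending on [s] leaves the integral, and what remains
    under it depends on [t] alone. *)
Lemma vint_separable p1 p2 q d r (N : R -> R -> 'M[R]_(q, p2))
    (F : 'I_r -> R -> 'M[R]_(q, d)) (H : 'I_r -> R -> 'M[R]_(d, p2))
    (z : Zrep R (p1, p2)) (E : set R) s :
  inZ a b z -> (forall i, bounded_meas a b (H i)) ->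
  measurable (E : set (measurableTypeR R)) -> E `<=` `[a, b] ->
  (forall t, t \in `[a, b] -> N s t = \sum_(i < r) F i s *m H i t) ->
  vint E (fun t => N s t *m z.2 t) =
  \sum_(i < r) F i s *m vint E (fun t => H i t *m z.2 t).
Proof.
move=> Hz bH mE Eab NE; apply/matrixP => j k; rewrite mxE summxE.
have mab := measurable_itvR a b.
have iH i l : mu.-integrable E (EFin \o (fun t => (H i t *m z.2 t) l 0)).
  have /inZP/(_ l)/sqint_integrable := inZ_mul 0 (bH i) Hz.
  exact: integrableS.
have iFH i l : mu.-integrable E (EFin \o (fun t => F i s j l * (H i t *m z.2 t) l 0)).
  by have := integrableZl mE (F i s j l) (iH i l); apply: eq_integrable.
have iFH' i : mu.-integrable E (EFin \o (fun t => \sum_l F i s j l * (H i t *m z.2 t) l 0)).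
  have : mu.-integrable E (fun t => \sum_l (F i s j l * (H i t *m z.2 t) l 0)%:E)%E.
    by apply: integrable_sum => // l _; exact: iFH.
  by apply: eq_integrable => // t _; rewrite sumEFin.
transitivity (\int[mu]_(t in E) \sum_(i < r) \sum_l F i s j l * (H i t *m z.2 t) l 0).
  apply: eq_Rintegral => t; rewrite inE => /Eab tab.
  rewrite NE// mulmx_suml summxE; apply: eq_bigr => i _.
  by rewrite -mulmxA mxE.
rewrite Rintegral_sum//; apply: eq_bigr => i _.
rewrite Rintegral_sum// mxE; apply: eq_bigr => l _.
by rewrite RintegralZl// mxE.
Qed.

(** Each summand is multiplication by [H i], then plain integration over [E s], then multiplication
    by [F i]. The intermediate spaces carry functions only, hence their finite-dimensional part of
    size 0. *)
Lemma adjointable_separable p1 p2 q1 q2 (N : R -> R -> 'M[R]_(q2, p2))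
    (E : R -> set R) :
  separable a b N ->
  (forall s, s \in `[a, b] -> measurable (E s : set (measurableTypeR R)) /\ E s `<=` `[a, b]) ->
  (forall d, adjointable a b
     (fun z : Zrep R (0%N, d) => inr_Z 0 (fun s => vint (E s) z.2))) ->
  adjointable a b (fun z : Zrep R (p1, p2) =>
    inr_Z q1 (fun s => vint (E s) (fun t => N s t *m z.2 t))).
Proof.
move=> [r [d [F [H [bF bH NE]]]]] EP VE.
apply: (@adjointable_ext _ _ _ _ _ (fun z : Zrep R (p1, p2) => \sum_(i < r)
  ((fun z : Zrep R (0%N, d) => inr_Z q1 (fun s => F i s *m z.2 s)) \o
   (fun z : Zrep R (0%N, d) => inr_Z 0 (fun s => vint (E s) z.2)) \o
   (fun z : Zrep R (p1, p2) => inr_Z 0 (fun s => H i s *m z.2 s))) z)).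
  move=> z Hz; split.
    by rewrite sumZ1 big1.
  move=> s sab; have [mEs Es] := EP s sab.
  rewrite sumZ2 /= (vint_separable (F := F) (H := H) Hz)// => t tab.
  exact: NE.
apply: adjointable_sum => i.
exact: (adjointable_comp (adjointable_comp (adjointable_mul p1 0 (bH i)) (VE d))
  (adjointable_mul 0 q1 (bF i))).
Qed.

Lemma adjointable_PI p q (K : PIop a b p q) : adjointable a b K.
Proof.
case: p q K => [p1 p2] [q1 q2] [P Q1 Q2 R0 R1 R2 bQ1 bQ2 bR0 sR1 sR2] /=.
have aP := adjointable_mx a b p2 q2 P.
have aQ1 : adjointable a b (fun z : Zrep R (p1, p2) =>
    inl_Z q2 (vint `[a, b] (fun s => Q1 s *m z.2 s))).
  have aI : adjointable a b (fun z : Zrep R (0%N, q1) => inl_Z q2 (vint `[a, b] z.2)).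
    by eexists; exact: adjoint_pair_int.
  exact: (adjointable_comp (adjointable_mul p1 0 bQ1) aI).
have aQ2 : adjointable a b (fun z : Zrep R (p1, p2) => inr_Z q1 (fun s => Q2 s *m z.1)).
  (* Embedding vectors as constant functions is the adjoint of integration over [a, b]. *)
  have aJ : adjointable a b (fun z : Zrep R (p1, p2) => inr_Z 0 (fun=> z.1)).
    by eexists; apply: adjoint_pair_sym; exact: adjoint_pair_int.
  exact: (adjointable_comp aJ (adjointable_mul 0 q1 bQ2)).
have aR0 := adjointable_mul p1 q1 bR0.
have aR1 : adjointable a b (fun z : Zrep R (p1, p2) =>
    inr_Z q1 (fun s => vint `[a, s] (fun t => R1 s t *m z.2 t))).
  apply: adjointable_separable => //.
    by move=> s sab; split; [exact: measurable_itvR|exact: subset_itv_l].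
  by move=> d; eexists; exact: adjoint_pair_volterra.
have aR2 : adjointable a b (fun z : Zrep R (p1, p2) =>
    inr_Z q1 (fun s => vint `[s, b] (fun t => R2 s t *m z.2 t))).
  apply: adjointable_separable => //.
    by move=> s sab; split; [exact: measurable_itvR|exact: subset_itv_r].
  (* Integration over [s, b] is the adjoint of integration over [a, s]. *)
  by move=> d; eexists; apply: adjoint_pair_sym; exact: adjoint_pair_volterra.
apply: adjointable_ext (adjointableD (adjointableD aP aQ1)
  (adjointableD (adjointableD (adjointableD aQ2 aR0) aR1) aR2)) => z Hz.
split; first by rewrite /= !addr0.
by move=> s _; rewrite /= !add0r.
Qed.

End PIoperators.

(** * Quadratic forms along signals *)

Lemma cvg_dominated (R : realType) (T : Type) (F : set_system T) (FF : Filter F)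
  (f g : T -> R) (l : R) :
  (\forall x \near F, `|f x - l| <= g x) -> g @ F --> (0 : R) -> f @ F --> l.
Proof.
move=> fg g0; apply/cvgrPdist_lt => e e0.
have ge : \forall x \near F, `|g x| < e by apply: (cvgr_norm_lt _ g0); rewrite normr0.
move: fg ge; apply: filterS2 => x fx gx; rewrite distrC.
by apply: le_lt_trans fx _; apply: le_lt_trans gx; exact: ler_norm.
Qed.

Section forms.
Context (R : realType) (a b : R).
Local Notation mu := (@lebesgue_measure R).
Local Notation "<< z , w >>" := (innerZ a b z w).
Local Notation nrm := (normZ a b).

(** Existence of some adjoint rules out the default value of [xget]; later arguments use the chosen
    one only through this property. *)
Lemma adjointP n m (K : Zrep R n -> Zrep R m) (w : Zrep R m) :
  adjointable a b K -> inZ a b w -> inZ a b (adjoint a b K w) /\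
  forall z, inZ a b z -> <<K z, w>> = <<z, adjoint a b K w>>.
Proof.
move=> [K' [k1 k2 k3 _]] Hw; rewrite /adjoint.
have ex : exists v, [set v | inZ a b v /\
    forall z, inZ a b z -> <<K z, w>> = <<z, v>>] v.
  by exists (K' w) => /=; split; [exact: k2|move=> z Hz; exact: k3].
by have [] := xgetPex 0 ex.
Qed.

Lemma adjointable_inZ n m (K : Zrep R n -> Zrep R m) z :
  adjointable a b K -> inZ a b z -> inZ a b (K z).
Proof. by move=> [K' [k1 _ _ _]]; exact: k1. Qed.

Lemma adjointable_id n : adjointable a b (fun z : Zrep R n => z).
Proof. by exists id; split => //; exists 1 => // z _; rewrite mul1r. Qed.

Lemma adjointable_ZDl n m (K : Zrep R n -> Zrep R m) c z w y :
  adjointable a b K -> inZ a b z -> inZ a b w -> inZ a b y ->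
  <<K (c *: z + w), y>> = c * <<K z, y>> + <<K w, y>>.
Proof.
move=> [K' [k1 k2 k3 _]] Hz Hw Hy.
by rewrite !k3//; [apply: innerZ_ZDl => //; exact: k2|exact: inZ_ZD].
Qed.

Lemma adjointable_eql n m (K : Zrep R n -> Zrep R m) z w y :
  adjointable a b K -> inZ a b z -> inZ a b w -> inZ a b y ->
  nrm (z - w) = 0 -> <<K z, y>> = <<K w, y>>.
Proof.
move=> [K' [k1 k2 k3 _]] Hz Hw Hy zw.
by rewrite !k3//; apply: innerZ_eql => //; exact: k2.
Qed.

Lemma form_eq n (K : Zrep R n -> Zrep R n) z w :
  adjointable a b K -> inZ a b z -> inZ a b w ->
  nrm (z - w) = 0 -> <<z, K z>> = <<w, K w>>.
Proof.
move=> aK Hz Hw zw.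
have Kz := adjointable_inZ aK Hz.
by rewrite (innerZ_eql Hz Hw Kz zw) innerZC (adjointable_eql aK Hz Hw Hw zw) innerZC.
Qed.

(** The form of a simple function is a finite combination of indicators, and forms of simple
    approximations converge at each time because [K] is bounded. *)
Lemma measurable_form n (K : Zrep R n -> Zrep R n) (y : R -> Zrep R n) :
  adjointable a b K -> (forall t : R, 0 <= t -> inZ a b (y t)) ->
  strongly_measurableZ a b y ->
  measurable_fun (`[0, +oo[ : set (measurableTypeR R)) (fun t => <<y t, K (y t)>>).
Proof.
move=> [K' [k1 k2 k3 [M M0 kM]]] Hy [f [sf fy]].
apply: (@measurable_fun_cvg _ _ _ _ (fun j t => <<f j t, K (f j t)>>)).
  move=> j; have [r [E [c [mE Hc fE]]]] := sf j.
  (* One slot expands directly; the other does so after [K] has been moved across as [K']. *)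
  rewrite (_ : (fun t => _) = (fun t => \sum_(i < r) \sum_(l < r)
      \1_(E i) t * (\1_(E l) t * <<c l, K' (c i)>>))).
    apply: measurable_sum => i; apply: measurable_sum => l.
    apply: measurable_funM; first exact: measurable_indic.
    by apply: measurable_funM; [exact: measurable_indic|exact: measurable_cst].
  apply/funext => t; rewrite fE; set z := \sum_(i < r) (\1_(E i) t : R) *: c i.
  have Hic i : inZ a b ((\1_(E i) t : R) *: c i) by exact: inZZ.
  have Hz : inZ a b z by apply: inZ_sum.
  have Hkz := k1 _ Hz.
  rewrite {1}/z innerZ_suml//; apply: eq_bigr => i _.
  rewrite innerZZl// -mulr_sumr; congr (_ * _).
  have Hkc := k2 _ (Hc i).
  rewrite innerZC k3// {1}/z innerZ_suml//; apply: eq_bigr => l _.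
  by rewrite innerZZl.
move=> t; rewrite /= in_itv/= andbT => t0; have yt := Hy t t0.
have Hf j : inZ a b (f j t).
  have [r [E [c [mE Hc ->]]]] := sf j.
  by apply: inZ_sum => i; exact: inZZ.
have Kyt := k2 _ yt.
(* The two summands bound [<<f - y, K f>>] and [<<f - y, K' y>>], whose sum is the difference of the
   forms. *)
apply: (@cvg_dominated _ _ _ _ _ (fun j => nrm (f j t - y t) *
   (M * (nrm (f j t - y t) + nrm (y t)) + nrm (K' (y t))))).
  apply: nearW => j; have Kf := k1 _ (Hf j); have Ky := k1 _ yt.
  have Hd := inZB (Hf j) yt.
  have -> : <<f j t, K (f j t)>> - <<y t, K (y t)>> =
      <<f j t - y t, K (f j t)>> + <<f j t - y t, K' (y t)>>.
    by rewrite !innerZBl// -!k3// !(innerZC _ _ (K _)) ; lra.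
  apply: le_trans (ler_normD _ _) _; rewrite mulrDr; apply: lerD.
    apply: le_trans (CauchySchwarzZ Hd Kf) _; rewrite ler_wpM2l ?normZ_ge0//.
    apply: le_trans (kM _ (Hf j)) _; rewrite ler_wpM2l//.
    by have := normZ_triangle Hd yt; rewrite subrK.
  exact: CauchySchwarzZ.
have d0 := fy t t0.
rewrite -[X in _ --> X](mul0r (M * (0 + nrm (y t)) + nrm (K' (y t)))).
apply: cvgM => //; apply: cvgD; last exact: cvg_cst.
apply: cvgM; first exact: cvg_cst.
by apply: cvgD => //; exact: cvg_cst.
Qed.

Lemma integrable_form n (K : Zrep R n -> Zrep R n) (y : R -> Zrep R n) (tau : R) :
  adjointable a b K -> inLe a b y -> 0 <= tau ->
  mu.-integrable `[0, tau] (EFin \o (fun t => <<y t, K (y t)>>)).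
Proof.
move=> aK [Hy sy iy] tau0.
have sub : `[0, tau] `<=` (`[0, +oo[ : set R) by apply: subset_itvl; rewrite bnd_simp.
have mq : measurable_fun `[0, tau] (fun t => <<y t, K (y t)>>).
  by apply: measurable_funS (measurable_form aK Hy sy) => //; exact: measurable_itv.
have mn : measurable_fun `[0, tau] (fun t => <<y t, y t>>).
  have mid : measurable_fun (`[0, +oo[ : set (measurableTypeR R)) (fun t => <<y t, y t>>).
    exact: measurable_form (adjointable_id n) Hy sy.
  by apply: measurable_funS mid => //; exact: measurable_itv.
have iN : mu.-integrable `[0, tau] (EFin \o (fun t => <<y t, y t>>)).
  apply/integrableP; split; first exact/measurable_EFinP.
  have := iy tau tau0; congr (_ < _)%E; apply: eq_integral => t _ /=.
  by rewrite normZ_sqr ger0_norm// innerZ_ge0.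
have [K' [k1 k2 k3 [M M0 kM]]] := aK.
have := integrableZl (measurable_itvR 0 tau) M iN.
apply: le_integrable => //; first exact/measurable_EFinP.
move=> t; rewrite /= in_itv/= => /andP[t0 _]; have yt := Hy t t0.
rewrite lee_fin [leRHS]ger0_norm ?mulr_ge0 ?innerZ_ge0//.
apply: le_trans (CauchySchwarzZ yt (k1 _ yt)) _.
by rewrite -normZ_sqr expr2 mulrCA ler_wpM2l ?normZ_ge0// kM.
Qed.

(** Over a time span shorter than [d] the signal moves by less than 1, which bounds it near each
    time; [interval_induction] spreads the bound to all of [0, tau]. *)
Lemma loc_abs_cont_bounded n (v : R -> Zrep R n) (tau : R) : 0 < tau ->
  loc_abs_cont a b v -> (forall t : R, 0 <= t -> inZ a b (v t)) ->
  exists2 N : R, 0 <= N & forall t, 0 <= t <= tau -> nrm (v t) <= N.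
Proof.
move=> tau0 acv Hv.
have [d d0 Hd] := acv tau tau0 1 ltr01.
pose P (l h : R) := exists2 N : R, 0 <= N & forall t, l <= t <= h -> nrm (v t) <= N.
apply: (@interval_induction _ tau P); first exact: ltW.
  move=> l m h [N N0 PN] [N' N'0 PN']; exists (N + N'); first exact: addr_ge0.
  move=> t /andP[lt th]; have [tm|mt] := leP t m.
    by apply: le_trans (PN t _) _; rewrite ?lt//; lra.
  by apply: le_trans (PN' t _) _; rewrite ?(ltW mt)//; lra.
move=> t /andP[t0 ttau]; exists d => // l h l0 htau tdl lt th htd.
have step p q : 0 <= p -> p <= q -> q <= tau -> q - p < d -> nrm (v q - v p) < 1.
  move=> p0 pq qtau pqd.
  have := Hd 1%N (fun=> p) (fun=> q); rewrite !big_ord1; apply => //.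
  by move=> i j; rewrite !ord1 eqxx.
exists (nrm (v t) + 1); first by rewrite addr_ge0 ?normZ_ge0.
move=> s /andP[ls sh].
have s0 : 0 <= s by lra.
have vs := Hv s s0; have vt := Hv t t0; have vd := inZB vs vt.
have vd1 : nrm (v s - v t) < 1.
  have [ts|st] := leP t s; first by apply: step => //; lra.
  by rewrite -normZN// opprB; apply: step => //; lra.
by have := normZ_triangle vd vt; rewrite subrK; lra.
Qed.

Section symmetric_form.
Context (n : nat * nat) (P : Zrep R n -> Zrep R n).
Hypothesis aP : adjointable a b P.
Hypothesis symP : forall z w, inZ a b z -> inZ a b w -> <<P z, w>> = <<z, P w>>.

(** Symmetry makes the cross terms agree, leaving the increment [z - w] as a factor of both
    terms. *)
Lemma form_sub z w : inZ a b z -> inZ a b w ->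
  <<z, P z>> - <<w, P w>> = <<z - w, P z>> + <<z - w, P w>>.
Proof.
move=> Hz Hw; have Pz := adjointable_inZ aP Hz; have Pw := adjointable_inZ aP Hw.
by rewrite !innerZBl// -(symP Hz Hw) (innerZC _ _ (P z)); lra.
Qed.

Lemma form_abs_cont (v : R -> Zrep R n) (tau : R) : 0 < tau ->
  loc_abs_cont a b v -> (forall t : R, 0 <= t -> inZ a b (v t)) ->
  abs_cont_on tau (fun t => <<v t, P (v t)>>).
Proof.
move=> tau0 acv Hv e e0.
have [N N0 vN] := loc_abs_cont_bounded tau0 acv Hv.
have [P' [p1 _ _ [M M0 pM]]] := aP.
have MN0 : 0 <= M * N by exact: mulr_ge0.
(* An increment of [v] is magnified at most [2 * (M * N)] times by the form; adding 1 makes the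
   divisor positive. *)
have c0 : 0 < 2 * (M * N) + 1 by lra.
have [d d0 Hd] := acv tau tau0 _ (divr_gt0 e0 c0).
exists d => // r l h Hlh dis sd; have := Hd r l h Hlh dis sd.
rewrite ltr_pdivlMr// => H; apply: le_lt_trans H.
rewrite mulr_suml; apply: ler_sum => i _; have [l0 lh htau] := Hlh i.
have h0 : 0 <= h i by lra.
have vl := Hv _ l0; have vh := Hv _ h0; have vd := inZB vh vl.
have NP t : 0 <= t <= tau -> nrm (P (v t)) <= M * N.
  move=> ht; have /andP[t0 _] := ht.
  by apply: le_trans (pM _ (Hv t t0)) _; rewrite ler_wpM2l// vN.
rewrite form_sub//; apply: le_trans (ler_normD _ _) _.
have H1 := CauchySchwarzZ vd (p1 _ vh); have H2 := CauchySchwarzZ vd (p1 _ vl).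
have n0 := normZ_ge0 a b (v (h i) - v (l i)).
have H3 : nrm (v (h i) - v (l i)) * nrm (P (v (h i))) <= nrm (v (h i) - v (l i)) * (M * N).
  by rewrite ler_wpM2l// NP// h0.
have H4 : nrm (v (h i) - v (l i)) * nrm (P (v (l i))) <= nrm (v (h i) - v (l i)) * (M * N).
  by rewrite ler_wpM2l// NP// l0; lra.
lra.
Qed.

(** Write [v (t + h) = v t + h *: (r + w)], where the norm [rho h] of [r] tends to 0. The quotient
    then differs from the limit by [2 * <<r, P (v t)>> + h * <<r + w, P (r + w)>>]. *)
Lemma form_deriv (v : R -> Zrep R n) (t : R) (w : Zrep R n) : 0 < t ->
  (forall t : R, 0 <= t -> inZ a b (v t)) -> inZ a b w ->
  has_derivZ a b v t w ->
  h^-1 * (<<v (t + h), P (v (t + h))>> - <<v t, P (v t)>>) @[h --> (0 : R)^'] -->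
  2 * <<v t, P w>>.
Proof.
move=> t0 Hv Hw dv.
have [P' [p1 _ _ [M M0 pM]]] := aP.
have vt := Hv t (ltW t0); have Pvt := p1 _ vt; have Pw := p1 _ Hw.
pose rho := fun h : R => nrm (h^-1 *: (v (t + h) - v t) - w).
have rho0 : rho h @[h --> (0 : R)^'] --> (0 : R) := dv.
apply: (@cvg_dominated _ _ _ _ _ (fun h => 2 * (rho h * nrm (P (v t))) +
   `|h| * ((nrm w + rho h) * (M * (nrm w + rho h))))).
  near=> h.
  have h0 : h != 0 by near: h; exact: nbhs_dnbhs_neq.
  (* The limit is two-sided, while [v] is controlled at nonnegative times only. *)
  have th : 0 <= t + h.
    have : `|h| < t by near: h; apply: dnbhs0_lt.
    by rewrite ltr_norml => /andP[]; lra.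
  have vth := Hv _ th; have vd := inZB vth vt.
  set r := h^-1 *: (v (t + h) - v t) - w.
  have Hr : inZ a b r by apply: inZB => //; exact: inZZ.
  have Hrw := inZD Hr Hw; have Hhrw := inZZ h Hrw.
  have dE : v (t + h) = h *: (r + w) + v t.
    by rewrite /r subrK scalerA divff// scale1r subrK.
  have Pr := p1 _ Hr; have Prw := p1 _ Hrw; have Pvth := p1 _ vth.
  have E1 : <<v (t + h), P (v (t + h))>> - <<v t, P (v t)>> =
     h * (2 * << r, P (v t)>> + 2 * <<v t, P w>> + h * << r + w, P (r + w)>>).
    rewrite form_sub//.
    have -> : v (t + h) - v t = h *: (r + w) by rewrite dE addrK.
    rewrite !innerZZl//.
    rewrite [in <<_, P (v (t + h))>>]innerZC [in P (v (t + h))]dE adjointable_ZDl//.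
    rewrite (innerZC _ _ (P (v t))) (innerZC _ _ (P (r + w))) !(innerZDl Hr Hw)//.
    by rewrite -(symP vt Hw) (innerZC _ _ (P (v t)) w); ring.
  rewrite E1 mulKf//.
  have -> : 2 * << r, P (v t)>> + 2 * <<v t, P w>> + h * << r + w, P (r + w)>> -
    2 * <<v t, P w>> = 2 * << r, P (v t)>> + h * << r + w, P (r + w)>> by ring.
  apply: le_trans (ler_normD _ _) _; apply: lerD.
    by rewrite normrM ger0_norm// ler_wpM2l//; exact: CauchySchwarzZ.
  rewrite normrM ler_wpM2l//; apply: le_trans (CauchySchwarzZ Hrw Prw) _.
  have tri : nrm (r + w) <= nrm w + rho h.
    by rewrite addrC; exact: normZ_triangle.
  apply: ler_pM; rewrite ?normZ_ge0//.
  by apply: le_trans (pM _ Hrw) _; rewrite ler_wpM2l.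
have idc : (h @[h --> (0 : R)^'] --> (0 : R)) by exact: nbhs_dnbhs.
have nc : (`|h| @[h --> (0 : R)^'] --> (0 : R)) by rewrite -[X in _ --> X](@normr0 _ R); exact: cvg_norm.
rewrite -[X in _ --> X](_ : 2 * (0 * nrm (P (v t))) +
    0 * ((nrm w + 0) * (M * (nrm w + 0))) = 0); last by ring.
apply: cvgD.
  by apply: cvgM; [exact: cvg_cst|apply: cvgM; [exact: rho0|exact: cvg_cst]].
have rhow : nrm w + rho h @[h --> (0 : R)^'] --> nrm w + 0.
  by apply: cvgD; [exact: cvg_cst|exact: rho0].
apply: cvgM; first exact: nc.
by apply: cvgM; [exact: rhow|apply: cvgM; [exact: cvg_cst|exact: rhow]].
Unshelve. all: by end_near. Qed.

End symmetric_form.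
End forms.

(** * The dissipation inequality *)

Lemma Rintegral_itv_diff (R : realType) (g : R -> R) (l h : R) :
  (@lebesgue_measure R).-integrable setT (EFin \o g) -> 0 <= l -> l <= h ->
  \int[@lebesgue_measure R]_(t in `[0, h]) g t -
  \int[@lebesgue_measure R]_(t in `[0, l]) g t =
  \int[@lebesgue_measure R]_(t in `]l, h]) g t.
Proof.
move=> ig l0 lh; rewrite Rintegral_itvB ?bnd_simp//.
by apply: integrableS ig => //; exact: measurable_itvR.
Qed.

(** The integral of [|g|] over a set is small when the measure of the set is small; this is applied
    to the union of the given intervals. *)
Lemma abs_cont_on_primitive (R : realType) (g : R -> R) (tau : R) :
  (@lebesgue_measure R).-integrable setT (EFin \o g) ->
  abs_cont_on tau (fun t => \int[@lebesgue_measure R]_(s in `[0, t]) g s).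
Proof.
move=> ig e e0; set mu := @lebesgue_measure R.
have [d [d0 Hd]] := integral_normr_continuous ig e0.
exists d => // r l h Hlh dis sd.
(* Half-open, so that intervals sharing an endpoint are still disjoint. *)
pose F (i : 'I_r) : set (measurableTypeR R) := `]l i, h i]%classic.
have mF i : measurable (F i) by exact: measurable_itv.
have tF : trivIset setT F.
  apply/trivIsetP => i j _ _ ij; rewrite -subset0 => x [].
  rewrite /F /= !in_itv/= => /andP[li hi] /andP[lj hj].
  by case: (dis i j ij); lra.
pose U := \big[setU/set0]_(i < r) F i.
have mU : measurable U by exact: bigsetU_measurable.
have Ud : (mu U < d%:E)%E.
  have -> : mu U = (\sum_(i < r) mu (F i))%E by exact: measure_bigsetU_ord.
  rewrite (eq_bigr (fun i => (h i - l i)%:E)); last first.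
    move=> i _; have [_ lh _] := Hlh i.
    rewrite [LHS](lebesgue_measure_itv `]l i, h i])/= lte_fin; case: ltP => // hl.
    by have -> : h i = l i by [lra]; rewrite subrr.
  by rewrite sumEFin lte_fin.
apply: le_lt_trans (Hd U mU Ud).
have ing := integrable_norm ig.
have ingA A : measurable A -> mu.-integrable A (EFin \o (fun x => `|g x|)).
  by move=> mA; apply: integrableS ing.
have -> : \int[mu]_(x in U) `|g x| = \sum_(i < r) \int[mu]_(x in F i) `|g x|.
  rewrite /Rintegral /U ge0_integral_bigsetU//.
  - by rewrite sum_fine// => i _; apply: integrable_fin_num => //; exact: ingA.
  - exact: index_enum_uniq.
  - by apply: sub_trivIset tF.
  - exact: measurable_int (ingA _ mU).
apply: ler_sum => i _; have [l0 lh _] := Hlh i.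
rewrite Rintegral_itv_diff//; apply: le_normr_Rintegral => //.
by apply: integrableS ig.
Qed.

Lemma abs_cont_onD (R : realType) (tau : R) (f g : R -> R) :
  abs_cont_on tau f -> abs_cont_on tau g ->
  abs_cont_on tau (fun t => f t + g t).
Proof.
move=> acf acg e e0; have e20 : 0 < e / 2 by lra.
have [d d0 Hd] := acf _ e20; have [d' d'0 Hd'] := acg _ e20.
exists (Num.min d d'); first by rewrite lt_min d0.
move=> r l h Hlh dis; rewrite lt_min => /andP[sd sd'].
have := Hd r l h Hlh dis sd; have := Hd' r l h Hlh dis sd'.
set S1 := \sum_(i < r) _; set S2 := \sum_(i < r) _.
have : \sum_(i < r) `|f (h i) + g (h i) - (f (l i) + g (l i))| <= S2 + S1.
  rewrite -big_split; apply: ler_sum => i _ /=.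
  by rewrite opprD addrACA; exact: ler_normD.
lra.
Qed.

Section dissipation.
Context (R : realType) (a b : R).
Hypothesis hab : a < b.
Local Notation mu := (@lebesgue_measure R).
Local Notation "<< z , w >>" := (innerZ a b z w).
Local Notation nrm := (normZ a b).

(** Each chosen adjoint is moved back to the other slot; symmetry of [P] then identifies the paired
    terms of the blocks, whence the factor 2. *)
Lemma nsd_blockE (n m k : nat * nat) (T A P : Zrep R k -> Zrep R k)
  (B : Zrep R n -> Zrep R k) (C : Zrep R k -> Zrep R m) (D : Zrep R n -> Zrep R m)
  (K : Zrep R m -> Zrep R m) (eps : R) :
  adjointable a b T -> adjointable a b A -> adjointable a b P ->
  adjointable a b B -> adjointable a b C -> adjointable a b D ->
  adjointable a b K ->
  (forall z w, inZ a b z -> inZ a b w -> <<P z, w>> = <<z, P w>>) ->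
  nsd_block a b
       (block_op ((adjoint a b T \o P \o A) \+ (adjoint a b A \o P \o T))
                 (adjoint a b T \o P \o B)
                 (adjoint a b B \o P \o T)
                 (fun w : Zrep R n => eps *: w)
        \+ (col_op (adjoint a b C) (adjoint a b D) \o K \o row_op C D)) ->
  forall x u, inZ a b x -> inZ a b u ->
  2 * <<T x, P (A x + B u)>> + eps * <<u, u>> +
  <<C x + D u, K (C x + D u)>> <= 0.
Proof.
move=> aT aA aP aB aC aD aK symP H x u Hx Hu.
have Tx := adjointable_inZ aT Hx; have Ax := adjointable_inZ aA Hx.
have Bu := adjointable_inZ aB Hu; have Cx := adjointable_inZ aC Hx.
have Du := adjointable_inZ aD Hu; have Hy := inZD Cx Du.
have Ky := adjointable_inZ aK Hy.
have PAx := adjointable_inZ aP Ax; have PBu := adjointable_inZ aP Bu.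
have PTx := adjointable_inZ aP Tx.
have [i1 e1] := adjointP aT PAx; have [i2 e2] := adjointP aA PTx.
have [i3 e3] := adjointP aT PBu; have [i4 e4] := adjointP aB PTx.
have [i5 e5] := adjointP aC Ky; have [i6 e6] := adjointP aD Ky.
have : <<x, (adjoint a b T (P (A x)) + adjoint a b A (P (T x)) +
             adjoint a b T (P (B u))) + adjoint a b C (K (C x + D u))>> +
       <<u, (adjoint a b B (P (T x)) + eps *: u) + adjoint a b D (K (C x + D u))>> <= 0.
  exact: (H (x, u) Hx Hu).
have i7 := inZZ eps Hu; have i8 := inZD i1 i2; have i9 := inZD i8 i3.
have i10 := inZD i4 i7.
rewrite !innerZDr// innerZZr// -!e1// -e2// -e3// -e4// -e5// -e6//.
rewrite [X in _ + X <= 0 -> _](_ : _ = <<B u, P (T x)>> + eps * <<u, u>> + <<D u, K (C x + D u)>>)//.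
have -> : <<T x, P (A x + B u)>> = <<T x, P (A x)>> + <<T x, P (B u)>>.
  by rewrite -!symP//; [exact: innerZDr|exact: inZD].
have -> : <<C x + D u, K (C x + D u)>> =
  <<C x, K (C x + D u)>> + <<D u, K (C x + D u)>> by exact: innerZDl.
rewrite -(symP (A x)) // -(symP (B u)) // (innerZC _ _ (P (A x))) (innerZC _ _ (P (B u))).
lra.
Qed.

(** [psd] identifies [P w] with the chosen adjoint only up to [eqZ], a difference that an inner
    product does not see. *)
Lemma psd_sym n (P : Zrep R n -> Zrep R n) : adjointable a b P -> psd a b P ->
  forall z w, inZ a b z -> inZ a b w -> <<P z, w>> = <<z, P w>>.
Proof.
move=> aP [eP _] z w Hz Hw; have [i1 e1] := adjointP aP Hw.
rewrite e1// innerZC [RHS]innerZC; symmetry.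
have Pw := adjointable_inZ aP Hw.
by apply: innerZ_eql => //; apply: eqZ_normZ0 => //; exact: eP.
Qed.

Lemma innerL_trunc n (y w : R -> Zrep R n) (tau : R) :
  innerL a b (trunc tau y) (trunc tau w) =
  \int[mu]_(t in `[0, tau]) <<y t, w t>>.
Proof.
have -> : `[0, tau]%classic = `[0, +oo[ `&` `[0, tau] :> set R.
  by rewrite setIidr//; apply: subset_itvl; rewrite bnd_simp.
rewrite Rintegral_mkcondr; apply: eq_Rintegral => t _.
rewrite /trunc patchE mem_setE in_itv/=; case: ifP => // _.
exact: innerZ0l (inZ0 _ _ _).
Qed.

Lemma normL_trunc n (y : R -> Zrep R n) (tau : R) :
  normL a b (trunc tau y) ^+ 2 = \int[mu]_(t in `[0, tau]) <<y t, y t>>.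
Proof.
rewrite /normL sqr_sqrtr innerL_trunc//.
by apply: Rintegral_ge0 => t _; exact: innerZ_ge0.
Qed.

Lemma dissipation (n m k : nat * nat) (T A P : Zrep R k -> Zrep R k)
  (B : Zrep R n -> Zrep R k) (C : Zrep R k -> Zrep R m) (D : Zrep R n -> Zrep R m)
  (K : Zrep R m -> Zrep R m) (eps : R) u x y (tau : R) :
  adjointable a b T -> adjointable a b A -> adjointable a b P ->
  adjointable a b B -> adjointable a b C -> adjointable a b D ->
  adjointable a b K ->
  psd a b P ->
  (forall x u, inZ a b x -> inZ a b u ->
    2 * <<T x, P (A x + B u)>> + eps * <<u, u>> +
    <<C x + D u, K (C x + D u)>> <= 0) ->
  inLe a b u -> inLe a b x -> inLe a b y -> state_eq a b T A B u x ->
  eqLe a b y (mulop C x + mulop D u) -> 0 < tau ->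
  \int[mu]_(t in `[0, tau]) (eps * <<u t, u t>> + <<y t, K (y t)>>) <= 0.
Proof.
move=> aT aA aP aB aC aD aK psdP lmi Lu Lx Ly [v [Hv vTx acv v0 dv]] yE tau0.
have symP := psd_sym aP psdP.
have Hx : forall t : R, 0 <= t -> inZ a b (x t) by case: Lx.
have Hu : forall t : R, 0 <= t -> inZ a b (u t) by case: Lu.
have Hy : forall t : R, 0 <= t -> inZ a b (y t) by case: Ly.
pose g t := eps * <<u t, u t>> + <<y t, K (y t)>>.
have ig : mu.-integrable `[0, tau] (EFin \o g).
  have iu : mu.-integrable `[0, tau] (EFin \o (fun t => <<u t, u t>>)).
    exact: (integrable_form (adjointable_id a b n) Lu (ltW tau0)).
  have iy := integrable_form aK Ly (ltW tau0).
  have mt := measurable_itvR 0 tau.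
  by have := integrableD mt (integrableZl mt eps iu) iy; apply: eq_integrable.
(* Cutting [g] off gives an integrable function on the whole line, as the results on primitives
   require. *)
pose gt : R -> R := g \_ `[0, tau].
have igt : mu.-integrable setT (EFin \o gt).
  by rewrite -restrict_EFin; apply/integrable_restrict => //; rewrite setTI.
pose Gt t := \int[mu]_(s in `[0, t]) gt s.
(* This sum starts at 0, so once it is known not to increase, positivity of [P] at time [tau] leaves
   the integral of [g] nonpositive. *)
have := @abs_cont_on_le R tau (fun t => <<v t, P (v t)>> + Gt t) tau0.
have -> : Gt 0 = 0 by rewrite /Gt set_itv1 Rintegral_set1.
have -> : Gt tau = \int[mu]_(t in `[0, tau]) g t.
  by apply: eq_Rintegral => t tt; rewrite /gt patchE tt.
have -> : <<v 0, P (v 0)>> = 0.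
  have H0 := inZ0 a b k; have Hv0 := Hv 0 (lexx 0).
  rewrite (form_eq aP Hv0 H0 (eqZ_normZ0 v0 Hv0 H0)) innerZ0l//.
  exact: adjointable_inZ.
have : 0 <= <<v tau, P (v tau)>> by case: psdP => _; apply; apply: Hv; exact: ltW.
move=> Pge H; suff : <<v tau, P (v tau)>> + \int[mu]_(t in `[0, tau]) g t <= 0 + 0 by lra.
apply: H.
  apply: abs_cont_onD; last exact: abs_cont_on_primitive.
  exact: form_abs_cont aP symP _ _ tau0 acv Hv.
have aeF : Filter (almost_everywhere mu) := ae_filter_ringOfSetsType mu.
have dG : {ae mu, forall t, 0 < t ->
    h^-1 * (Gt (t + h) - Gt t) @[h --> (0 : R)^'] --> gt t}.
  have iloc : locally_integrable [set: R] gt.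
    by apply: integrable_locally => //; exact: measurable_itvR.
  have igty r : mu.-integrable [set` Interval (BLeft 0) (BRight r)] (EFin \o gt).
    by apply: integrableS igt => //; exact: measurable_itvR.
  have := FTC1 igty iloc; apply: filterS => t tFTC t0; have t0' := ltW t0.
  have [|dGt <-] := tFTC; first by rewrite lte_fin.
  rewrite derive1E.
  suff -> : (fun h : R => h^-1 * (Gt (t + h) - Gt t)) =
      (fun h : R => h^-1 *: (Gt (h *: 1 + t) - Gt t)) by exact: dGt.
  by apply/funext => h; rewrite [h *: 1]mulr1 [h + t]addrC.
(* Almost every time satisfies the state equation, [v = T x], the output equation and the
   differentiation theorem for [Gt] at once. *)
apply: (@filterS _ _ aeF _ _ _ (filterI (filterI dv vTx) (filterI yE dG))).
move=> t [[dvt vTxt] [yEt dGt]] /andP[t0 ttau].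
have t0' := ltW t0.
have Hxt := Hx t t0'; have Hut := Hu t t0'; have Hyt := Hy t t0'; have Hvt := Hv t t0'.
have Tx := adjointable_inZ aT Hxt.
have Hw : inZ a b (A (x t) + B (u t)).
  by apply: inZD; [exact: adjointable_inZ Hxt|exact: adjointable_inZ Hut].
have Hcd : inZ a b (C (x t) + D (u t)).
  by apply: inZD; [exact: adjointable_inZ Hxt|exact: adjointable_inZ Hut].
exists (2 * <<v t, P (A (x t) + B (u t))>> + gt t).
  have -> : gt t = g t by rewrite /gt patchE mem_setE in_itv/= t0' ltW.
  rewrite /g (form_eq aK Hyt Hcd); last exact: eqZ_normZ0 (yEt t0') _ _.
  (* The derivative was computed with [v t]; the operator inequality speaks of [T (x t)]. *)
  rewrite (innerZ_eql (z' := T (x t))) //.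
  - by have := lmi _ _ Hxt Hut; lra.
  - exact: adjointable_inZ Hw.
  - by apply: eqZ_normZ0 => //; exact: vTxt.
suff -> : (fun h : R => h^-1 *
     (<<v (t + h), P (v (t + h))>> + Gt (t + h) - (<<v t, P (v t)>> + Gt t))) =
   (fun h : R => h^-1 * (<<v (t + h), P (v (t + h))>> - <<v t, P (v t)>>) +
     h^-1 * (Gt (t + h) - Gt t)).
  apply: cvgD; last exact: dGt.
  by apply: form_deriv => //; exact: dvt.
by apply/funext => h; ring.
Qed.

End dissipation.

Theorem lemma7 (R : realType) (a b : R) (n m k : nat * nat) (hab : a < b)
    (G : (R -> Zrep R n) -> (R -> Zrep R m))
    (hG : Le_operator a b G) (hGlin : Le_linear a b G)
    (hGcausal : causal a b G) (hGbounded : Le_bounded a b G)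
    (T A : PIop a b k k) (B : PIop a b n k)
    (C : PIop a b k m) (D : PIop a b n m)
    (hsys : forall u, inLe a b u -> forall y, inLe a b y -> eqLe a b y (G u) ->
       exists x, [/\ inLe a b x, state_eq a b T A B u x &
                     eqLe a b y (mulop C x + mulop D u)])
    (K : PIop a b m m) (eps : R) (heps : 0 < eps)
    (P : PIop a b k k) (hP : psd a b P)
    (hLMI : nsd_block a b
       (block_op ((adjoint a b T \o P \o A) \+ (adjoint a b A \o P \o T))
                 (adjoint a b T \o P \o B)
                 (adjoint a b B \o P \o T)
                 (fun w : Zrep R n => eps *: w)
        \+ (col_op (adjoint a b C) (adjoint a b D) \o K \o row_op C D))) :
  forall u, inLe a b u -> forall tau : R, 0 < tau ->
    innerL a b (trunc tau (G u)) (trunc tau (mulop K (G u)))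
      <= - eps * normL a b (trunc tau u) ^+ 2.
Proof.
move=> u Lu tau tau0.
have Ly : inLe a b (G u) by case: hG => + _; apply.
have yy : eqLe a b (G u) (G u) by apply: aeW => t _; split => //; exact: aeW.
have [x [Lx st yE]] := hsys u Lu (G u) Ly yy.
have aK := adjointable_PI hab K; have aP := adjointable_PI hab P.
have lmi := nsd_blockE (adjointable_PI hab T) (adjointable_PI hab A) aP
  (adjointable_PI hab B) (adjointable_PI hab C) (adjointable_PI hab D) aK
  (psd_sym aP hP) hLMI.
have := dissipation (adjointable_PI hab T) (adjointable_PI hab A) aP
  (adjointable_PI hab B) (adjointable_PI hab C) (adjointable_PI hab D) aK
  hP lmi Lu Lx Ly st yE tau0.
have iu := integrable_form (adjointable_id a b n) Lu (ltW tau0).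
have iy := integrable_form aK Ly (ltW tau0).
have mt := measurable_itvR 0 tau.
rewrite innerL_trunc normL_trunc RintegralD//; last first.
  by have := integrableZl mt eps iu; apply: eq_integrable.
rewrite RintegralZl// /mulop; lra.
Qed.
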